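(* Let $p\ne2,3$ be a prime. There is a curve in $\mathsf T/\mathbb F_p:=\mathrm{Spec}\,\mathbb F_p[t_1,t_2,t_3,\frac1\Delta]$, $\Delta=27t_3^2-t_2^3$, which is invariant by the Ramanujan vector field $\mathsf v$ and whose $\mathfrak k$-rational points (for $\mathfrak k$ a perfect field of characteristic $p$) correspond to triples $(E,\alpha,\omega)$ such that $C(\alpha)=\alpha$ and $C(\omega)=0$, where $C$ is the Cartier operator.
   Context: The Ramanujan vector field is $$\mathsf v=(t_1^2-\tfrac1{12}t_2)\frac{\partial}{\partial t_1}+(4t_1t_2-6t_3)\frac{\partial}{\partial t_2}+(6t_1t_3-\tfrac13t_2^2)\frac{\partial}{\partial t_3}.$$ A curve with ideal $I$ is invariant by $\mathsf v$ if $\mathsf v(I)\subset I$. $\mathsf T$ is the moduli space of triples $(E,\alpha,\omega)$, where $E$ is an elliptic curve and $\alpha,\omega$ is a basis of $H^1_{\mathrm{dR}}(E)$ with $\alpha\in F^1H^1_{\mathrm{dR}}(E)=H^0(E,\Omega^1_E)$ and $\langle\alpha,\omega\rangle=1$ (cup product pairing, normalized as for the family below). The point $(t_1,t_2,t_3)$ corresponds to the elliptic curve $y^2=4(x-t_1)^3-t_2(x-t_1)-t_3$ with $\alpha=[\frac{dx}{y}]$, $\omega=[\frac{x\,dx}{y}]$. The Cartier operator on a curve over a perfect field of characteristic $p$ is the unique additive map $C:\Omega^1\to\Omega^1$ with $C(f^p\eta)=fC(\eta)$, $C(df)=0$, $C(f^{p-1}df)=df$. It induces a map $C:H^1_{\mathrm{dR}}(E)\to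 H^0(E,\Omega^1_E)$: if a class is represented on an open cover $\{U_0,U_1\}$ by $(\omega_0,\omega_1,f_{10})$ with $\omega_1-\omega_0=df_{10}$, its image is the gluing of $C(\omega_0)$ and $C(\omega_1)$, which agree on $U_0\cap U_1$. *)

(* Defs.v *)
From HB Require Import structures.
From mathcomp Require Import all_boot all_order all_algebra.
From mathcomp Require Import ring boolp.
From mathcomp Require Export mpoly.

Set Implicit Arguments.
Unset Strict Implicit.
Unset Printing Implicit Defensive.

Import GRing.Theory.
Local Open Scope ring_scope.
Local Open Scope quotient_scope.

Local Notation "x %:F" := (@FracField.tofrac _ x).

Section Ideals.
Variable A : comNzRingType.
Implicit Types I P Q : {pred A}.

(* Ideals are proper: this is part of [idealr_closed]. *)
Definition prime_ideal P := idealr_closed P /\ prime_idealr_closed P.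

Definition radical_ideal I := forall (a : A) (n : nat), a ^+ n \in I -> a \in I.

Definition strict_subset P Q := {subset P <= Q} /\ ~ {subset Q <= P}.

Definition prime_chain I (n : nat) (Ps : nat -> {pred A}) :=
  (forall i, (i <= n)%N -> prime_ideal (Ps i) /\ {subset I <= Ps i}) /\
  (forall i, (i < n)%N -> strict_subset (Ps i) (Ps i.+1)).

(* the quotient ring A / I has Krull dimension n *)
Definition krull_dim_quotient I (n : nat) :=
  (exists Ps, prime_chain I n Ps) /\ ~ (exists Ps, prime_chain I n.+1 Ps).

Definition minimal_prime I P :=
  [/\ prime_ideal P, {subset I <= P} &
      forall Q, prime_ideal Q -> {subset I <= Q} -> {subset Q <= P} ->
        {subset P <= Q}].

(* Ideal of a curve: a nonempty reduced closed subscheme of Spec A, all of    *)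
(* whose irreducible components have dimension one.  Without reducedness,     *)
(* invariance would be void in characteristic p: derivations kill p-th        *)
(* powers, so the p-th powers of the elements of any ideal generate an ideal  *)
(* that is invariant by every vector field.                                   *)
Definition curve_ideal I :=
  [/\ idealr_closed I, radical_ideal I &
      forall P, minimal_prime I P -> krull_dim_quotient P 1].

Definition invariant_ideal (v : A -> A) I := forall a, a \in I -> v a \in I.

End Ideals.

Section FracDerivation.
Variables (R : idomainType) (delta : R -> R).

(* Extension of a derivation to the fraction field by the quotient rule. *)
Definition frac_der (x : {fraction R}) : {fraction R} :=
  let n := \n_(repr x) in let d := \d_(repr x) in
  (delta n * d - n * delta d)%:F / (d ^+ 2)%:F.

Lemma frac_repr (x : {fraction R}) : x = (\n_(repr x))%:F / (\d_(repr x))%:F.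
Proof.
rewrite -[LHS]reprK; move: (repr x) => r.
have r0 : \d_r != 0 by rewrite denom_ratioP.
have rF0 : (\d_r)%:F != 0 by rewrite tofrac_eq0.
apply: (mulIf rF0); rewrite mulfVK //.
unlock FracField.tofrac; rewrite -[LHS]FracField.pi_mul /FracField.mulf.
apply/eqmodP; rewrite /= FracField.equivfE.
by rewrite !numden_Ratio ?oner_eq0 ?mulr1 ?mul1r // mulrC.
Qed.

Lemma frac_derE (a b : R) :
  (forall u v, delta (u * v) = delta u * v + u * delta v) -> b != 0 ->
  frac_der (a%:F / b%:F) = (delta a * b - a * delta b)%:F / (b ^+ 2)%:F.
Proof.
move=> deltaM b0; rewrite /frac_der; set x := a%:F / b%:F.
have := frac_repr x; have := denom_ratioP (repr x).
move: (\n_(repr x)) (\d_(repr x)) => n d d0 xE.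
have bF0 : b%:F != 0 by rewrite tofrac_eq0.
have dF0 : d%:F != 0 by rewrite tofrac_eq0.
have /eqP : a%:F / b%:F == n%:F / d%:F by rewrite -xE.
move/eqP; rewrite eqr_div // -!tofracM tofrac_eq => /eqP nb.
have dnb : delta a * d + a * delta d = delta n * b + n * delta b.
  by rewrite -!deltaM nb.
apply/eqP; rewrite eqr_div ?tofrac_eq0 ?expf_neq0 // -!tofracM tofrac_eq.
apply/eqP.
transitivity (b * d * (delta n * b + n * delta b) - (n * b) * (b * delta d + d * delta b)).
  by ring.
by rewrite -dnb -nb; ring.
Qed.

End FracDerivation.

(* The scheme T over F_p, its coordinate ring being the subring of fractions  *)
(* f / Delta ^ n of the fraction field of F_p[t1, t2, t3], and the Ramanujan  *)
(* vector field as a derivation of this ring.                                 *)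

Section CoordinateRing.
Variable p : nat.
Local Notation S := {mpoly 'F_p[3]}.

Definition T1 : S := 'X_(inord 0).
Definition T2 : S := 'X_(inord 1).
Definition T3 : S := 'X_(inord 2).

Definition Delta : S := 27%:R * T3 ^+ 2 - T2 ^+ 3.

Definition in_OT : {pred {fraction S}} :=
  fun x => `[< exists (f : S) (n : nat), x = f%:F / Delta%:F ^+ n >].

Lemma Delta_neq0 : Delta != 0.
Proof.
apply/eqP=> /(congr1 (fun f : S => f.@[fun i : 'I_3 => (i == inord 1)%:R])).
rewrite /Delta /T2 /T3 !(rmorphB, rmorphM, rmorphXn, rmorph_nat, rmorph0) /=.
rewrite !mevalXU eqxx -val_eqE /= !inordK //=.
rewrite !mul1r mul0r mulr0 sub0r.
by move/eqP; rewrite oppr_eq0 oner_eq0.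
Qed.

Lemma DeltaF_neq0 n : Delta%:F ^+ n != 0.
Proof. by rewrite expf_neq0 // tofrac_eq0 Delta_neq0. Qed.

Lemma in_OT_subring : subring_closed in_OT.
Proof.
split=> [|x y|x y].
- by apply/asboolP; exists 1, 0%N; rewrite expr0 divr1 tofrac1.
- move=> /asboolP [f [n ->]] /asboolP [g [m ->]]; apply/asboolP.
  have := DeltaF_neq0; move: Delta => D D0.
  exists (f * D ^+ m - g * D ^+ n), (n + m)%N.
  rewrite tofracB (tofracM f) (tofracM g) !tofracXn -mulNr addf_div // exprD.
  by rewrite mulNr.
- move=> /asboolP [f [n ->]] /asboolP [g [m ->]]; apply/asboolP.
  by exists (f * g), (n + m)%N; rewrite tofracM exprD mulf_div.
Qed.

HB.instance Definition _ :=
  GRing.isSubringClosed.Build {fraction S} in_OT in_OT_subring.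

Record OT : predArgType := MkOT { OTval : {fraction S}; _ : OTval \in in_OT }.

HB.instance Definition _ := [isSub for OTval].
HB.instance Definition _ := [Choice of OT by <:].
HB.instance Definition _ := [SubChoice_isSubComNzRing of OT by <:].

Lemma OT_of_poly_subproof (f : S) : f%:F \in in_OT.
Proof. by apply/asboolP; exists f, 0%N; rewrite expr0 divr1. Qed.

Definition OT_of_poly (f : S) : OT := MkOT (OT_of_poly_subproof f).

Definition ramanujan_poly (f : S) : S :=
  (T1 ^+ 2 - 12%:R^-1 *: T2) * f^`M(inord 0)
  + (4%:R * T1 * T2 - 6%:R * T3) * f^`M(inord 1)
  + (6%:R * T1 * T3 - 3%:R^-1 *: T2 ^+ 2) * f^`M(inord 2).

Lemma ramanujan_polyM f g :
  ramanujan_poly (f * g) = ramanujan_poly f * g + f * ramanujan_poly g.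
Proof. by rewrite /ramanujan_poly !mderivM; ring. Qed.

Lemma ramanujan_subproof (x : OT) : frac_der ramanujan_poly (OTval x) \in in_OT.
Proof.
case: x => x /= /asboolP [f [n ->]]; apply/asboolP.
have := Delta_neq0; move: Delta => D D0.
rewrite -tofracXn frac_derE ?expf_neq0 //; last exact: ramanujan_polyM.
exists (ramanujan_poly f * D ^+ n - f * ramanujan_poly (D ^+ n)).
by exists (n * 2)%N; rewrite -tofracXn exprM.
Qed.

Definition ramanujan (x : OT) : OT := MkOT (ramanujan_subproof x).

End CoordinateRing.

Section EllipticCurve.
Variables (p : nat) (k : fieldType) (t1 t2 t3 : k).
Local Notation kx := {fraction {poly k}}.

Definition weierstrass_cubic : {poly k} :=
  4%:R *: ('X - t1%:P) ^+ 3 - t2 *: ('X - t1%:P) - t3%:P.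
Local Notation f := weierstrass_cubic.

(* The function field k(x)[y] / (y^2 - f) of E : y^2 = f(x); the quotient is  *)
(* a field when 2 != 0 in k, as f then has odd degree.  Its elements coerce   *)
(* to polynomials a + b y over k(x).                                          *)
Definition function_field : predArgType :=
  {poly %/ ('X^2 - (f%:F)%:P : {poly kx})}.
HB.instance Definition _ := GRing.ComUnitRing.on function_field.
Local Notation K := function_field.

Definition of_kx (r : kx) : K := qpolyC _ r.
Definition of_k (c : k) : K := of_kx (c%:P)%:F.
Definition xE : K := of_kx 'X%:F.
Definition yE : K := 'qX.
(* the function x - t1 *)
Definition XE : K := xE - of_k t1.

(* Omega^1_{K/k} is free with basis dx (K is finite separable over k(x)), and *)
(* g : K stands for g dx.                                                     *)
Definition differential := K.

(* differentiates a + b y with d/dx on coefficients in k(x) and               *)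
(* dy = f' / (2 y) dx                                                         *)
Definition dE (g : K) : differential :=
  in_qpoly _ (map_poly (frac_der (@deriv k)) g)
  + in_qpoly _ (g : {poly kx})^`() * (of_kx (f^`())%:F / (2%:R * yE)).

Definition is_cartier (C : differential -> differential) :=
  [/\ forall w w', C (w + w') = C w + C w',
      forall (g : K) w, C (g ^+ p * w) = g * C w,
      forall g : K, C (dE g) = 0 &
      forall g : K, C (g ^+ p.-1 * dE g) = dE g].

(* the subring k[a, b] of K *)
Definition adjoin2 (a b : K) (g : K) :=
  exists P : {poly {poly k}}, g = (map_poly (fun q => (map_poly of_k q).[a]) P).[b].

(* E is covered by two affine opens: U0, the complement of the point O at     *)
(* infinity, and U1, the complement of {x = t1}, on which the coordinates     *)
(* u = 1 / (x - t1) and w = y / (x - t1)^2 embed U1 as the plane curve        *)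
(* w^2 = 4 u - t2 u^3 - t3 u^4, O being (0, 0).                               *)
Definition O_U0 : K -> Prop := adjoin2 XE yE.
Definition O_U1 : K -> Prop := adjoin2 XE^-1 (yE / XE ^+ 2).
Definition O_U01 (g : K) := exists n, O_U0 (XE ^+ n * g).

(* The A-submodule of Omega^1_{K/k} spanned by the differentials of elements  *)
(* of A.  It is Omega^1(U) for A = O(U), as U is smooth.                      *)
Definition Omega (A : K -> Prop) (w : differential) :=
  exists s : seq (K * K), (forall ab, ab \in s -> A ab.1 /\ A ab.2) /\
    w = \sum_(ab <- s) ab.1 * dE ab.2.

(* H^0(E, Omega^1) *)
Definition global_differential (w : differential) := Omega O_U0 w /\ Omega O_U1 w.

(* H^1_dR(E) as the Cech hypercohomology of {U0, U1}; a class is the set of  *)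
(* cocycles representing it.                                                  *)
Record dR_cochain := DRCochain {
  form0 : differential; form1 : differential; fun10 : K }.

Definition dR_cocycle (c : dR_cochain) :=
  [/\ Omega O_U0 (form0 c), Omega O_U1 (form1 c), O_U01 (fun10 c) &
      form1 c - form0 c = dE (fun10 c)].

Definition dR_cohomologous (c c' : dR_cochain) :=
  exists g0 g1 : K, [/\ O_U0 g0, O_U1 g1,
    form0 c' - form0 c = dE g0, form1 c' - form1 c = dE g1 &
    fun10 c' - fun10 c = g1 - g0].

Definition dR_class (c : dR_cochain) : dR_cochain -> Prop :=
  fun c' => dR_cocycle c' /\ dR_cohomologous c c'.

(* dx / y *)
Definition dx_over_y : differential := yE^-1.

Definition alpha := dR_class (DRCochain dx_over_y dx_over_y 0).

(* x dx / y has a double pole at O and no residue; its class is represented   *)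
(* with f10 = - y / (2 (x - t1)), which has a simple pole at O, and           *)
(* x dx / y + d f10 is regular on U1.                                         *)
Definition omega :=
  let f10 := - (yE / (2%:R * XE)) in
  dR_class (DRCochain (xE * dx_over_y) (xE * dx_over_y + dE f10) f10).

(* The map H^1_dR(E) -> H^0(E, Omega^1) induced by C sends the class cl to w. *)
Definition cartier_dR (C : differential -> differential)
    (cl : dR_cochain -> Prop) (w : differential) :=
  global_differential w /\
  exists c, [/\ cl c, C (form0 c) = w & C (form1 c) = w].

(* C(alpha) = alpha and C(omega) = 0 *)
Definition cartier_condition (C : differential -> differential) :=
  cartier_dR C alpha dx_over_y /\ cartier_dR C omega 0.

End EllipticCurve.

(* Main.v *)
Require Import Defs.
From HB Require Import structures.
From mathcomp Require Import all_boot all_order all_algebra.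
From mathcomp Require Import ring zify boolp wochoice.

(** Let n = (p - 1) / 2 and g = 4 X^3 - t2 X - t3, where X = x - t1, and let A
    and B be the coefficients of degrees p - 1 and p - 2 of g^n.  Since
    1 / y = y^(-p) g^n, the Cartier operator sends dx / y to A^(1/p) dx / y and
    x dx / y to (B + t1 A)^(1/p) dx / y.  The two conditions on (E, alpha, omega)
    thus say A = 1 and t1 = - B, and the curve is the one with ideal
    I = (A - 1, t1 + B): [cartier_conditionE], [curve_points].  The choice of
    cocycles is harmless because C kills exact forms; that dx / y and x dx / y
    do define classes is checked on the two charts of the elliptic curve
    ([dx_regular0], [dx_regular1], [xdx_at_infinity]).

    Invariance.  A derivation of the coefficients a, b of g that acts on them
    like v changes g^n by - X g^n, plus an exact derivative, plus a weight term.
    In degree p - 1 an exact derivative has coefficient zero; in degree p - 2 its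
    coefficient is computed from A ([hasse_coef_relation]).  This gives analogues
    of Ramanujan's relations, v(A) = - t1 A - B and 12 v(B) = 12 t1 B + t2 A
    ([der_hasse], [der_cohasse]), whence v(A - 1) = - t1 (A - 1) - (t1 + B) and
    v(t1 + B) = t1 (t1 + B) + (t2 / 12) (A - 1).

    I is the ideal of a curve.  Eliminating t1 turns it into the plane curve
    A = 1 outside Delta = 0 ([mem_curveP]).

    - It is reduced ([curve_radical]): the polynomial A is homogeneous of weight
      n, so the Euler field E satisfies 2 E(A) = - A and A - 1 has no multiple
      factor.
    - It is not empty ([curve_idealr_closed]): A is not zero, because its value
      at a nodal cubic is 12^n ([hasse_nodal]), and it has positive weight, so
      that A - 1 does not divide a power of the homogeneous polynomial Delta.
    - Its dimension is at most one: by counting dimensions, any two functions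
      are algebraically dependent modulo I ([curve_dependence]), which excludes
      chains of three primes ([no_prime_chain2]).
    - Each component has dimension at least one.  As I is reduced and invariant
      by v, so is each minimal prime P over it ([minimal_prime_invariant]).  If
      all functions were algebraic over F_p modulo P, then v would map them into
      P ([algebraic_der]), whereas v has no zero outside Delta = 0
      ([ramanujan_no_zero]).  So some function s is transcendental modulo P.  The
      quotient by P becomes integral over F_p[s, 1/c] when some nonzero c in
      F_p[s] is inverted, so that c s + 1, prime to c, is not a unit modulo P,
      and P is not maximal ([exists_larger_prime]). *)

Set Implicit Arguments.
Unset Strict Implicit.
Unset Printing Implicit Defensive.

Import GRing.Theory.
Local Open Scope ring_scope.

Local Notation "x %:F" := (@FracField.tofrac _ x).

(** * Derivations *)

Definition derivation (R : nzRingType) (D : R -> R) :=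
  (forall x y, D (x + y) = D x + D y) /\
  (forall x y, D (x * y) = D x * y + x * D y).

Section Derivation.
Variables (R : comNzRingType) (D : R -> R).
Hypothesis derD : derivation D.

Lemma der0 : D 0 = 0.
Proof. by apply: (addrI (D 0)); rewrite -derD.1 !addr0. Qed.

Lemma derN x : D (- x) = - D x.
Proof. by apply: (addrI (D x)); rewrite -derD.1 !subrr der0. Qed.

Lemma derB x y : D (x - y) = D x - D y.
Proof. by rewrite derD.1 derN. Qed.

Lemma der1 : D 1 = 0.
Proof. by apply: (addrI (D 1)); rewrite -{3}[1]mulr1 derD.2 mulr1 mul1r addr0. Qed.

Lemma der_nat m : D m%:R = 0.
Proof. by elim: m => [|m IH]; rewrite ?der0 // -natr1 derD.1 IH der1 addr0. Qed.

Lemma der_natM m x : D (m%:R * x) = m%:R * D x.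
Proof. by rewrite derD.2 der_nat mul0r add0r. Qed.

Lemma derX x m : D (x ^+ m) = m%:R * x ^+ m.-1 * D x.
Proof.
elim: m => [|m IH]; first by rewrite expr0 der1 !mul0r.
rewrite exprS derD.2 IH /=; case: m {IH} => [|m]; first by rewrite !expr0; ring.
by rewrite /= !exprS -[m.+2%:R]natr1; ring.
Qed.

Lemma der_sum (I : Type) (r : seq I) (P : pred I) (F : I -> R) :
  D (\sum_(i <- r | P i) F i) = \sum_(i <- r | P i) D (F i).
Proof. by rewrite (big_morph D derD.1 der0). Qed.

Lemma coef_map_der (q : {poly R}) i : (map_poly D q)`_i = D q`_i.
Proof. by rewrite coef_map_id0 ?der0. Qed.

Lemma map_derC c : map_poly D c%:P = (D c)%:P.
Proof. by apply/polyP=> i; rewrite coef_map_der !coefC; case: ifP; rewrite ?der0. Qed.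

Lemma map_derX : map_poly D 'X = 0.
Proof.
by apply/polyP=> i; rewrite coef_map_der coefX coef0; case: eqP; rewrite ?der1 ?der0.
Qed.

Lemma map_poly_derivation : derivation (map_poly D).
Proof.
split=> q r; apply/polyP=> i.
  by rewrite coefD !coef_map_der coefD derD.1.
rewrite coefD coef_map_der !coefM der_sum -big_split /=; apply: eq_bigr => j _.
by rewrite derD.2 !coef_map_der.
Qed.

End Derivation.

(** * The Hasse invariant of y^2 = 4 x^3 - a x - b and its companion *)

Definition cubic (R : comNzRingType) (a b : R) : {poly R} :=
  4%:R *: 'X^3 - a *: 'X - b%:P.

Section HasseDef.
Variables (R : comNzRingType) (n : nat) (a b : R).

(** For p = 2 n + 1 these are the coefficients of degrees p - 1 and p - 2 that
    the Cartier operator extracts from dx / y and x dx / y. *)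
Definition hasse : R := (cubic a b ^+ n)`_(n.*2).
Definition cohasse : R := (cubic a b ^+ n)`_(n.*2.-1).

End HasseDef.

Lemma map_cubic (R S : comNzRingType) (h : {rmorphism R -> S}) a b :
  map_poly h (cubic a b) = cubic (h a) (h b).
Proof.
by rewrite /cubic !rmorphB /= !map_polyZ map_polyXn map_polyX map_polyC rmorph_nat.
Qed.

Lemma rmorph_hasse (R S : comNzRingType) (h : {rmorphism R -> S}) n a b :
  h (hasse n a b) = hasse n (h a) (h b).
Proof. by rewrite /hasse -map_cubic -rmorphXn /= coef_map. Qed.

Lemma rmorph_cohasse (R S : comNzRingType) (h : {rmorphism R -> S}) n a b :
  h (cohasse n a b) = cohasse n (h a) (h b).
Proof. by rewrite /cohasse -map_cubic -rmorphXn /= coef_map. Qed.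

Section HasseDerivation.
Variables (R : idomainType) (n : nat) (a b : R).
Hypotheses (charR : n.*2.+1 \in [pchar R]) (n_gt1 : (1 < n)%N).
Local Notation g := (cubic a b).
Local Notation A := (hasse n a b).
Local Notation B := (cohasse n a b).

Lemma pcharR_natr0 : (n.*2.+1)%:R = 0 :> R.
Proof. exact: pcharf0. Qed.

Lemma double_half_pchar : (2 * n%:R : R) = - 1.
Proof.
by apply/eqP; rewrite -subr_eq0 opprK -natrM natr1 mul2n pcharR_natr0.
Qed.

Lemma natr_small_neq0 m : (0 < m < 5)%N -> m%:R != 0 :> R.
Proof.
move=> m_bd; rewrite -(dvdn_pcharf charR); apply/negP => /dvdn_leq; lia.
Qed.

Lemma deriv_cubic : g^`() = 12%:R *: 'X^2 - a%:P.
Proof.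
rewrite /cubic !derivB !derivZ derivXn derivX derivC subr0 alg_polyC.
by rewrite -scalerMnr -!scaler_nat scalerA -natrM.
Qed.

Lemma cubicE : g = 4%:R * 'X ^+ 3 - a%:P * 'X - b%:P.
Proof. by rewrite /cubic -!mul_polyC polyC_natr. Qed.

Lemma deriv_cubicE : g^`() = 12%:R * 'X ^+ 2 - a%:P.
Proof. by rewrite deriv_cubic -!mul_polyC polyC_natr. Qed.

(** X^(p - 1) has no primitive in characteristic p. *)
Lemma coef_deriv_pred_pchar (q : {poly R}) : q^`()`_(n.*2) = 0.
Proof. by rewrite coef_deriv -mulr_natr pcharR_natr0 mulr0. Qed.

(** The coefficient of degree p - 1 vanishes in the derivative (n + 1) g^n g'
    of g^(n + 1). *)
Lemma hasse_coef_relation : 12%:R * (g ^+ n)`_(n.*2.-2) = a * A.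
Proof.
have := coef_deriv_pred_pchar (g ^+ n.+1).
rewrite deriv_exp /= deriv_cubic coefMn => /eqP.
rewrite -(mulr_natl _ n.+1) mulf_eq0 => /orP[/eqP n0|].
  have /eqP := congr1 ( *%R 2%:R) n0; rewrite mulr0 -[n.+1%:R]natr1 mulrDr mulr1.
  by rewrite double_half_pchar (_ : -1 + 2 = 1) ?oner_eq0 //; ring.
rewrite mulrBl -scalerAl coefB coefZ coefXnM coefCM subr_eq0.
rewrite ifF ?subn2; last by lia.
by move=> /eqP ->.
Qed.

Variables (D : R -> R) (u w : R).
Hypotheses (derD : derivation D).
Hypothesis Da : D a = 4%:R * u * a - 6%:R * w * b.
Hypothesis Db : 3%:R * D b = 18%:R * u * b - w * a ^+ 2.

Lemma map_der_cubic : map_poly D g = - (D a)%:P * 'X - (D b)%:P.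
Proof.
apply/polyP=> i; rewrite (coef_map_der derD) /cubic mulNr.
rewrite !coefB coefN !coefZ coefCM !coefC coefX coefXn.
rewrite !(derB derD) !(der_natM derD) derD.2.
have Dbool (c : bool) : D c%:R = 0 by rewrite der_nat.
by rewrite !Dbool !mulr0 addr0 sub0r; case: ifP; rewrite ?(der0 derD).
Qed.

(** The u-part of D is 2 u times the Euler field, for which X has weight 1 and g
    weight 3.  The w-part is the Gauss-Manin connection, which modulo exact forms
    sends dx / y to - w x dx / y; indeed g^n dx is dx / y times y^p, a constant
    for all derivations. *)
Lemma map_der_cubic_pow :
  6%:R * map_poly D (g ^+ n) =
    (12%:R * u)%:P * (3%:R * n%:R * g ^+ n - 'X * (g ^+ n)^`())
    + w%:P * (((12%:R *: 'X^2 - (2%:R * a)%:P) * g ^+ n)^`()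
              - 6%:R * 'X * g ^+ n).
Proof.
have derDp := map_poly_derivation derD.
have n_gt0 : (0 < n)%N by exact: ltnW.
have Dg3 : 3%:R * map_poly D g = - (12%:R * u * a - 18%:R * w * b)%:P * 'X
             - (18%:R * u * b - w * a ^+ 2)%:P.
  rewrite map_der_cubic -Db Da !(polyCB, polyCM, polyC_natr, polyCN); ring.
have N2 : 2%:R * n%:R = -1 :> {poly R}.
  by rewrite -!polyC_natr -polyCM double_half_pchar polyCN.
have Gpow : g ^+ n = g * g ^+ n.-1 by rewrite -exprS prednK.
have dG : (g ^+ n)^`() = n%:R * (12%:R * 'X ^+ 2 - a%:P) * g ^+ n.-1.
  by rewrite deriv_exp deriv_cubicE -(mulr_natl _ n) mulrA.
have dQ : (12%:R *: 'X^2 - (2%:R * a)%:P)^`() = 24%:R * 'X.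
  rewrite derivB derivZ derivXn derivC subr0 -scalerMnr expr1 -scaler_nat.
  by rewrite scalerA -natrM -mul_polyC polyC_natr.
rewrite derX // derivM dQ dG.
transitivity (2%:R * n%:R * g ^+ n.-1 * (3%:R * map_poly D g)).
  by ring.
rewrite Dg3 -mul_polyC Gpow; move: (g ^+ n.-1) => H.
transitivity ((12%:R * u)%:P * (3%:R * n%:R * (g * H)
      - 'X * (n%:R * (12%:R * 'X ^+ 2 - a%:P) * H))
    + w%:P * (24%:R * 'X * (g * H)
      + ((2%:R * n%:R) * (6%:R * 'X ^+ 2 - a%:P)) * ((12%:R * 'X ^+ 2 - a%:P) * H)
      - 6%:R * 'X * (g * H))); last by rewrite !(polyCM, polyC_natr); ring.
(* The factors 2 n are kept together so as to be replaced by - 1. *)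
rewrite cubicE.
transitivity (6%:R * u%:P * (2%:R * n%:R)
      * (3%:R * (4%:R * 'X ^+ 3 - a%:P * 'X - b%:P)
         - 'X * (12%:R * 'X ^+ 2 - a%:P)) * H
    + (2%:R * n%:R) * w%:P * (18%:R * b%:P * 'X + a%:P ^+ 2) * H).
  by rewrite !(polyCM, polyC_natr, polyCB, polyCN, rmorphXn) /=; ring.
rewrite N2 !(polyCM, polyC_natr).
transitivity (6%:R * u%:P * (2%:R * n%:R)
      * (3%:R * (4%:R * 'X ^+ 3 - a%:P * 'X - b%:P)
         - 'X * (12%:R * 'X ^+ 2 - a%:P)) * H
    + - 1 * w%:P * (18%:R * b%:P * 'X + a%:P ^+ 2) * H); first by rewrite N2.
by ring.
Qed.

Lemma der_coef_cubic_pow i : (0 < i)%N ->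
  6%:R * D (g ^+ n)`_i =
    12%:R * u * (3%:R * n%:R * (g ^+ n)`_i - i%:R * (g ^+ n)`_i)
    + w * (i.+1%:R * (12%:R * (g ^+ n)`_i.-1 - 2%:R * a * (g ^+ n)`_i.+1)
           - 6%:R * (g ^+ n)`_i.-1).
Proof.
case: i => // i _.
have /(congr1 (fun q : {poly R} => q`_i.+1)) := map_der_cubic_pow.
rewrite -!(polyC_natr _ 3) -!(polyC_natr _ 6) -(polyC_natr _ n) -!mulrA.
rewrite coefD !coefCM (coef_map_der derD) => ->.
rewrite !coefB !coefCM !coefXM !coef_deriv mulrBl coefB -scalerAl coefZ coefXnM.
rewrite coefCM !subSS subn0 /= -(mulr_natr (_ - _) i.+2).
by rewrite -(mulr_natr (g ^+ n)`_i.+1 i.+1); ring.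
Qed.

(** The Hasse invariant plays the role of the Eisenstein series E_(p-1), and
    its companion that of E_(p+1), in Ramanujan's relations modulo p. *)
Lemma der_hasse : D A = - (u * A) - w * B.
Proof.
have six0 : 6%:R != 0 :> R by rewrite (natrM _ 2 3) mulf_neq0 ?natr_small_neq0.
apply: (mulfI six0); rewrite der_coef_cubic_pow; last by rewrite double_gt0; lia.
rewrite pcharR_natr0 mul0r sub0r -/A -/B -mul2n natrM.
have -> : 12%:R * u * (3%:R * n%:R * A - 2%:R * n%:R * A) =
    6%:R * (2%:R * n%:R) * (u * A) by ring.
by rewrite double_half_pchar; ring.
Qed.

Lemma der_cohasse : 12%:R * D B = 12%:R * u * B + w * a * A.
Proof.
rewrite (natrM _ 2 6) -mulrA der_coef_cubic_pow; last by lia.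
have -> : n.*2.-1.+1 = n.*2 by lia.
have -> : n.*2.-1%:R = 2%:R * n%:R - 1 :> R.
  by rewrite -natrM mul2n -subn1 natrB; last lia.
rewrite -/B -/A -mul2n natrM -[w * a * A]mulrA -[2%:R * a * A]mulrA.
rewrite -hasse_coef_relation.
rewrite (mul2n n); move: (_`_n.*2.-2) => H; rewrite double_half_pchar.
have -> : 12%:R * u * (3%:R * n%:R * B - (-1 - 1) * B) =
    6%:R * u * (3%:R * (2%:R * n%:R) * B + 4%:R * B) by ring.
by rewrite double_half_pchar; ring.
Qed.

End HasseDerivation.

(** * The Hasse invariant is a nonconstant weighted homogeneous polynomial *)

(** At the nodal cubic 4 (x - 1)^2 (x + 2) the square of the double factor
    raised to the power n is (x - 1)^(p - 1) = 1 + x + ... + x^(p - 1), so the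
    coefficient of degree p - 1 is the value at 1 of the n-th power of the other
    factor, of degree n < p. *)
Lemma hasse_nodal (R : idomainType) (n : nat) : n.*2.+1 \in [pchar R] ->
  hasse n (12%:R : R) (- 8%:R) = 12%:R ^+ n.
Proof.
move=> charR.
have nodal : cubic (12%:R : R) (- 8%:R) = ('X - 1) ^+ 2 * (4%:R * 'X + 8%:R).
  by rewrite cubicE polyCN !polyC_natr; ring.
have geom : ('X - 1) ^+ n.*2 = \sum_(i < n.*2.+1) 'X^i :> {poly R}.
  have X1 : 'X - 1 != 0 :> {poly R} by rewrite -polyC1 polyXsubC_eq0.
  apply: (mulfI X1); rewrite -exprS -subrX1.
  have charP : n.*2.+1 \in [pchar {poly R}] by rewrite (rmorph_pchar (@polyC R)).
  rewrite -!(pFrobenius_autE charP) pFrobenius_autB_comm ?pFrobenius_aut1 //.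
  exact: commr1.
rewrite /hasse nodal exprMn -exprM mul2n geom coefM.
set L : {poly R} := 4%:R * 'X + 8%:R.
have szL : (size L <= 2)%N.
  rewrite /L -!polyC_natr (leq_trans (size_polyD _ _)) // geq_max.
  rewrite (leq_trans (size_polyC_leq1 _)) // andbT.
  by rewrite mul_polyC (leq_trans (size_scale_leq _ _)) ?size_polyX.
have szLn : (size (L ^+ n) <= n.*2.+1)%N.
  apply: leq_trans (size_poly_exp_leq _ _) _; rewrite ltnS -muln2 mulnC.
  by rewrite leq_mul2l -subn1 leq_subLR (leq_trans szL) ?orbT.
transitivity ((L ^+ n).[1]); last first.
  rewrite /L horner_exp hornerD hornerM hornerX -!polyC_natr !hornerC mulr1.
  by rewrite -natrD.
rewrite (horner_coef_wide _ szLn) [RHS](reindex_inj rev_ord_inj) /=.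
apply: eq_bigr => i _; rewrite expr1n mulr1 coef_sum subSS.
rewrite (bigD1 i) //= coefXn eqxx big1 ?addr0 ?mul1r // => j ji.
by rewrite coefXn eq_sym (inj_eq val_inj) (negbTE ji).
Qed.

Lemma coef_comp_poly_scaleX (R : comNzRingType) (q : {poly R}) z i :
  (q \Po (z *: 'X))`_i = z ^+ i * q`_i.
Proof.
elim/poly_ind: q i => [|q c IH] i; first by rewrite comp_poly0 coef0 mulr0.
rewrite comp_poly_MXaddC !coefD !coefC -scalerAr coefZ coefMX.
case: i => [|i] /=; first by rewrite coefMX mulr0 expr0 mul1r.
by rewrite coefMX /= !addr0 IH exprS mulrA.
Qed.

(** Scaling the coordinate x by z scales the cubic by z^3. *)
Lemma hasse_scale (R : idomainType) (n : nat) (a b z : R) : z != 0 ->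
  hasse n (z ^+ 2 * a) (z ^+ 3 * b) = z ^+ n * hasse n a b.
Proof.
move=> z0; have zX0 : z ^+ n.*2 != 0 by rewrite expf_neq0.
have sc : cubic (z ^+ 2 * a) (z ^+ 3 * b) \Po (z *: 'X) = (z ^+ 3)%:P * cubic a b.
  apply/polyP=> i; rewrite coef_comp_poly_scaleX coefCM /cubic.
  rewrite !coefB !coefZ !coefXn coefX !coefC.
  case: i => [|[|[|[|i]]]] /=; ring.
have := congr1 (fun q : {poly R} => (q ^+ n)`_(n.*2)) sc.
rewrite -rmorphXn coef_comp_poly_scaleX exprMn -rmorphXn coefCM -/(hasse _ _ _).
rewrite -/(hasse _ a b) -exprM (_ : 3 * n = n.*2 + n)%N; last by lia.
by move=> sc_n; apply: (mulfI zX0); rewrite sc_n exprD mulrA.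
Qed.

(** * Prime ideals *)

Section Ideals.
Variable A : comNzRingType.
Implicit Types J M P Q : {pred A}.

Lemma ideal_closed0 J : idealr_closed J -> 0 \in J. Proof. by case. Qed.

Lemma ideal_closed1F J : idealr_closed J -> (1 \in J) = false.
Proof. by case=> _ /negbTE. Qed.

Lemma ideal_closedMr J a u : idealr_closed J -> u \in J -> a * u \in J.
Proof. by case=> J0 _ JD Ju; rewrite -[_ * _]addr0 JD. Qed.

Lemma ideal_closedMl J a u : idealr_closed J -> u \in J -> u * a \in J.
Proof. by rewrite mulrC; apply: ideal_closedMr. Qed.

Lemma ideal_closedD J u v : idealr_closed J -> u \in J -> v \in J -> u + v \in J.
Proof. by case=> J0 _ JD Ju Jv; rewrite -[u]mul1r JD. Qed.

Lemma ideal_closedN J u : idealr_closed J -> u \in J -> - u \in J.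
Proof. by move=> idJ Ju; rewrite -mulN1r ideal_closedMr. Qed.

Lemma ideal_closedB J u v : idealr_closed J -> u \in J -> v \in J -> u - v \in J.
Proof. by move=> idJ Ju Jv; rewrite ideal_closedD ?ideal_closedN. Qed.

Lemma prime_idealM P u v : prime_ideal P -> (u * v \in P) = (u \in P) || (v \in P).
Proof.
case=> idlP prP; apply/idP/idP; first exact: prP.
by case/orP=> ?; [apply: ideal_closedMl | apply: ideal_closedMr].
Qed.

Lemma prime_idealX P u m : prime_ideal P -> u ^+ m \in P -> u \in P.
Proof.
move=> prP; elim: m => [|m IH]; first by rewrite (ideal_closed1F prP.1).
by rewrite exprS prime_idealM // => /orP[].
Qed.

Definition multiplicative_set M :=
  1 \in M /\ {in M &, forall u v, u * v \in M}.

Definition add_principal J (u : A) : {pred A} :=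
  fun x => `[< exists2 q, q \in J & exists r, x = q + r * u >].

Lemma add_principalP J u x : reflect
  (exists2 q, q \in J & exists r, x = q + r * u) (x \in add_principal J u).
Proof. exact: asboolP. Qed.

Lemma add_principal_sub J u : {subset J <= add_principal J u}.
Proof.
by move=> x Jx; apply/add_principalP; exists x => //; exists 0; rewrite mul0r addr0.
Qed.

Lemma add_principal_mem J u : idealr_closed J -> u \in add_principal J u.
Proof.
move=> idJ; apply/add_principalP; exists 0; first exact: ideal_closed0.
by exists 1; rewrite mul1r add0r.
Qed.

Lemma add_principal_ideal J u : idealr_closed J -> 1 \notin add_principal J u ->
  idealr_closed (add_principal J u).
Proof.
move=> idJ Ju1; split=> //; first by rewrite add_principal_sub ?ideal_closed0.
move=> a _ _ /add_principalP[q Jq [r ->]] /add_principalP[q' Jq' [r' ->]].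
apply/add_principalP; exists (a * q + q'); first by case: idJ => _ _; apply.
by exists (a * r + r'); ring.
Qed.

(** Krull: an ideal that is maximal among those avoiding M is prime. *)
Lemma prime_avoiding J M : idealr_closed J -> multiplicative_set M ->
    (forall a, a \in M -> a \notin J) ->
  exists P, [/\ prime_ideal P, {subset J <= P} & forall a, a \in M -> a \notin P].
Proof.
move=> idJ [M1 MM] MJ.
pose avoiding Q :=
  [/\ idealr_closed Q, {subset J <= Q} & forall a, a \in M -> a \notin Q].
pose S Q := `[< avoiding Q >].
pose R Q Q' := `[< {subset Q <= Q'} >].
have: {in S & &, transitive R}.
  by move=> X Y Z _ _ _ /asboolP XY /asboolP YZ; apply/asboolP=> x /XY/YZ.
have /Zorn's_lemma/[apply] : {in S, reflexive R} by move=> X _; apply/asboolP.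
case=> [C CS /(@wo_chainW {pred A}) chC | P /asboolP[idlP JP MP] maxP].
  have SJ : J \in S by apply/asboolP; split => // x.
  have [|C0] := pselect (exists Q, Q \in C); last first.
    by exists J => // Q CQ; case: C0; exists Q.
  case=> Q0 CQ0.
  pose U : {pred A} := fun x => `[< exists2 Q, Q \in C & x \in Q >].
  have UP x : reflect (exists2 Q, Q \in C & x \in Q) (x \in U) by exact: asboolP.
  have CS' Q : Q \in C -> avoiding Q by move=> /CS/asboolP.
  exists U; last by move=> Q CQ; apply/asboolP=> x Qx; apply/UP; exists Q.
  have MU a : a \in M -> a \notin U.
    by move=> Ma; apply/UP=> -[Q /CS'[_ _ /(_ a Ma)/negbTE->]].
  apply/asboolP; split=> //; last first.
    by move=> x Jx; apply/UP; exists Q0 => //; case: (CS' _ CQ0) => _ + _; apply.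
  split; [| exact: MU |].
    by apply/UP; exists Q0 => //; case: (CS' _ CQ0) => /ideal_closed0.
  move=> a u v /UP[Q CQ Qu] /UP[Q' CQ' Q'v].
  have [/asboolP QQ'|/asboolP Q'Q] := orP (chC _ _ CQ CQ').
    apply/UP; exists Q' => //; case: (CS' _ CQ') => -[_ _ Q'lin] _ _.
    by apply: Q'lin => //; apply: QQ'.
  apply/UP; exists Q => //; case: (CS' _ CQ) => -[_ _ Qlin] _ _.
  by apply: Qlin => //; apply: Q'Q.
exists P; split=> //; split=> // u v Puv.
apply: contraT; rewrite negb_or => /andP[Pu Pv].
have meetsM w : w \notin P -> exists2 m, m \in M & m \in add_principal P w.
  move=> Pw; apply: contrapT => noM.
  have noM' a : a \in M -> a \notin add_principal P w.
    by move=> Ma; apply/negP => Pa; apply: noM; exists a.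
  have /asboolP/(_ w) : R (add_principal P w) P.
    apply: maxP; last by apply/asboolP; apply: add_principal_sub.
    apply/asboolP; split=> //; first by apply: add_principal_ideal => //; apply: noM'.
    by move=> x /JP /add_principal_sub.
  by rewrite (negbTE Pw) add_principal_mem // => /(_ isT).
have [m Mm /add_principalP[q Pq [r em]]] := meetsM _ Pu.
have [m' Mm' /add_principalP[q' Pq' [r' em']]] := meetsM _ Pv.
have /negP[] := MP _ (MM _ _ Mm Mm').
rewrite em em' (_ : _ * _ = (q' + r' * v) * q + (r * u * q' + (r * r') * (u * v)));
  last by ring.
by do 2?[apply: (ideal_closedD idlP)]; apply: (ideal_closedMr _ idlP).
Qed.

(** In a reduced quotient the elements of a minimal prime are zero divisors:
    otherwise some prime inside P would avoid the powers of such an element. *)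
Lemma minimal_prime_zero_divisor J P a : idealr_closed J -> radical_ideal J ->
  minimal_prime J P -> a \in P -> exists2 b, b \notin P & a * b \in J.
Proof.
move=> idJ radJ [prP JP minP] Pa; apply: contrapT => nob.
pose M : {pred A} := fun x => `[< exists m, exists2 b, b \notin P & x = a ^+ m * b >].
have MP x : reflect (exists m, exists2 b, b \notin P & x = a ^+ m * b) (x \in M).
  exact: asboolP.
have P1 : 1 \notin P by rewrite (ideal_closed1F prP.1).
have mulM : multiplicative_set M.
  split; first by apply/MP; exists 0%N, 1; rewrite ?mulr1.
  move=> _ _ /MP[m [b Pb ->]] /MP[m' [b' Pb' ->]]; apply/MP.
  exists (m + m')%N, (b * b'); first by rewrite prime_idealM // negb_or Pb.
  by rewrite exprD; ring.
have [|Q [prQ JQ MQ]] := prime_avoiding idJ mulM.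
  move=> _ /MP[m [b Pb ->]]; apply/negP=> Jab; apply: nob; exists b => //.
  apply: (radJ _ m.+1); rewrite (_ : _ ^+ _ = (a * b ^+ m) * (a ^+ m * b)).
    by rewrite ideal_closedMr.
  by rewrite exprMn exprS (exprSr b); ring.
have /(minP Q prQ JQ) sPQ : {subset Q <= P}.
  move=> x Qx; apply: contraT => Px; suff: x \notin Q by rewrite Qx.
  by apply: MQ; apply/MP; exists 0%N, x; rewrite ?mul1r.
suff : a \notin Q by rewrite sPQ.
by apply: MQ; apply/MP; exists 1%N, 1; rewrite ?mulr1.
Qed.

(** An element a of P is killed modulo J by some b outside P, and
    D a * b = D (a * b) - a * D b is then in P. *)
Lemma minimal_prime_invariant (D : A -> A) J P : derivation D ->
  idealr_closed J -> radical_ideal J -> invariant_ideal D J ->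
  minimal_prime J P -> invariant_ideal D P.
Proof.
move=> derD idJ radJ invJ minP a Pa; have [prP JP _] := minP.
have [b Pb Jab] := minimal_prime_zero_divisor idJ radJ minP Pa.
have : D a * b \in P.
  rewrite (_ : D a * b = D (a * b) - a * D b); last by rewrite derD.2 addrK.
  by apply: (ideal_closedB prP.1); [apply/JP/invJ | apply: ideal_closedMl prP.1 _].
by rewrite prime_idealM // (negbTE Pb) orbF.
Qed.

Lemma prime_ideal_quotient P : prime_ideal P ->
  exists (B : comNzRingType) (h : {rmorphism A -> B}), forall a, (a \in P) = (h a == 0).
Proof.
case=> idlP prP.
pose I : idealr A := HB.pack P (isIdealr.Build A P idlP).
exists {ideal_quot I}, (\pi_({ideal_quot I})%qT) => a.
by rewrite -(rmorph0 (\pi_({ideal_quot I})%qT)) -(Quotient.idealrBE I) subr0.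
Qed.

End Ideals.

(** * Fractions *)

Section FracDerivation.
Variables (R : idomainType) (delta : R -> R).
Hypothesis derd : derivation delta.

Lemma frac_der_derivation : derivation (frac_der delta).
Proof.
have dM := derd.2.
split=> x y; rewrite (frac_repr x) (frac_repr y);
  move: (\n_(repr x)) (\d_(repr x)) (\n_(repr y)) (\d_(repr y))
    (denom_ratioP (repr x)) (denom_ratioP (repr y)) => a b c d b0 d0;
  have bF : b%:F != 0 by [rewrite tofrac_eq0];
  have dF : d%:F != 0 by [rewrite tofrac_eq0].
- rewrite addf_div // -!tofracM -tofracD !frac_derE ?mulf_neq0 //.
  rewrite derd.1 !dM !tofracXn addf_div ?expf_neq0 //.
  apply/eqP; rewrite eqr_div ?mulf_neq0 ?expf_neq0 ?tofrac_eq0 ?mulf_neq0 //.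
  rewrite -?tofracXn -?tofracM -?tofracD -?tofracM tofrac_eq; apply/eqP; ring.
- rewrite mulf_div -!tofracM !frac_derE ?mulf_neq0 //.
  rewrite !dM !mulf_div -!tofracM addf_div ?tofrac_eq0 ?mulf_neq0 ?expf_neq0 //.
  apply/eqP; rewrite eqr_div ?mulf_neq0 ?expf_neq0 ?tofrac_eq0 ?mulf_neq0 ?expf_neq0 //.
  rewrite -?tofracXn -?tofracM -?tofracD -?tofracM tofrac_eq; apply/eqP; ring.
Qed.

Lemma frac_der_tofrac a : frac_der delta a%:F = (delta a)%:F.
Proof.
have := frac_derE a derd.2 (oner_neq0 R).
by rewrite tofrac1 expr1n tofrac1 !divr1 (der1 derd) mulr0 subr0 mulr1.
Qed.

End FracDerivation.

(** * Polynomials in three variables over F_p *)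

Section Polynomials.
Variable p : nat.
Hypothesis p_pr : prime p.
Local Notation S := {mpoly 'F_p[3]}.

Lemma pcharS : p \in [pchar S].
Proof. by rewrite (rmorph_pchar (@mpolyC 3 _) (pchar_Fp p_pr)). Qed.

Lemma mderiv_comb_derivation (c : 'I_3 -> S) :
  derivation (fun F : S => \sum_i c i * F^`M(i)).
Proof.
split=> F G.
  by rewrite -big_split; apply: eq_bigr => i _; rewrite mderivD mulrDr.
rewrite mulr_suml mulr_sumr -big_split; apply: eq_bigr => i _ /=.
by rewrite mderivM; ring.
Qed.

Lemma Fp_exp_pchar (c : 'F_p) : c ^+ p = c.
Proof.
by rewrite -[c]natr_Zp -(pFrobenius_autE (pchar_Fp p_pr)) pFrobenius_aut_nat.
Qed.

(** All the exponents in F are multiples of p, and the coefficients are their own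
    p-th powers. *)
Lemma mpoly_pth_power (F : S) : (forall i, F^`M(i) = 0) -> exists G, F = G ^+ p.
Proof.
move=> dF0.
have pm m i : m \in msupp F -> (p %| m i)%N.
  rewrite mcoeff_msupp => Fm; apply: contraT => pmi.
  have mi : (0 < m i)%N by case: (m i) pmi => //; rewrite dvdn0.
  have := congr1 (mcoeff (m - U_(i))) (dF0 i).
  rewrite mcoeff_mderiv mcoeff0 submK; last by rewrite lep1mP -lt0n.
  rewrite mnmBE mnm1E eqxx subn1 prednK // -mulr_natr => /eqP.
  by rewrite mulf_eq0 (negbTE Fm) -(dvdn_pcharf (pchar_Fp p_pr)) (negbTE pmi).
exists (\sum_(m <- msupp F) F@_m *: 'X_[[multinom (m i %/ p)%N | i < 3]]).
rewrite -(pFrobenius_autE pcharS) raddf_sum [LHS]mpolyE /=.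
rewrite big_seq [RHS]big_seq; apply: eq_bigr => m Fm.
rewrite pFrobenius_autE exprZn Fp_exp_pchar mpolyXn; congr (_ *: 'X_[_]).
by apply/mnmP => i; rewrite mulmnE mnmE divnK ?pm.
Qed.

Lemma mpoly3_ind (P : S -> Prop) : P 1 ->
  (forall F G, P F -> P G -> P (F + G)) -> (forall F G, P F -> P G -> P (F * G)) ->
  P (T1 p) -> P (T2 p) -> P (T3 p) -> forall F, P F.
Proof.
move=> P1 PD PM PT1 PT2 PT3.
have Pnat m : P m.+1%:R by elim: m => [|m IH] //; rewrite -natr1; apply: PD.
have P0 : P 0.
  by rewrite -(pcharf0 pcharS); have := Pnat p.-1; rewrite prednK ?prime_gt0.
have PC (c : 'F_p) : P c%:MP.
  by rewrite -[c]natr_Zp (rmorph_nat (@mpolyC 3 'F_p)); case: (nat_of_ord c).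
have PX i : P 'X_i.
  suff : i \in [:: inord 0; inord 1; inord 2].
    by rewrite !inE => /or3P[] /eqP ->.
  by rewrite !inE -!val_eqE /= !inordK //; case: i => -[|[|[]]].
have PXn F m : P F -> P (F ^+ m).
  by move=> PF; elim: m => [|m IH]; rewrite ?expr0 // exprS; apply: PM.
elim/mpolyind => // c m F _ _ PF; apply: PD => //; rewrite -mul_mpolyC.
apply: (PM) => //; rewrite mpolyXE_id.
by apply: (big_ind P) => [//|G G'|i _]; [exact: PM | exact: PXn].
Qed.

Definition ev_at (R : comNzRingType) (h : 'F_p -> R) (x1 x2 x3 : R) : S -> R :=
  mmap h (fun i : 'I_3 => [:: x1; x2; x3]`_i).

Section Evaluation.
Variables (R : comNzRingType) (h : {rmorphism 'F_p -> R}) (x1 x2 x3 : R).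
HB.instance Definition _ := GRing.RMorphism.copy (ev_at h x1 x2 x3)
  (mmap h (fun i : 'I_3 => [:: x1; x2; x3]`_i)).

Lemma ev_atT1 : ev_at h x1 x2 x3 (T1 p) = x1.
Proof. by rewrite /ev_at /T1 mmapX mmap1U inordK. Qed.
Lemma ev_atT2 : ev_at h x1 x2 x3 (T2 p) = x2.
Proof. by rewrite /ev_at /T2 mmapX mmap1U inordK. Qed.
Lemma ev_atT3 : ev_at h x1 x2 x3 (T3 p) = x3.
Proof. by rewrite /ev_at /T3 mmapX mmap1U inordK. Qed.
Lemma ev_atC c : ev_at h x1 x2 x3 c%:MP = h c.
Proof. by rewrite /ev_at mmapC. Qed.

End Evaluation.

Lemma rmorph_eq_coordinates (R : comNzRingType) (h h' : {rmorphism S -> R}) :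
  h (T1 p) = h' (T1 p) -> h (T2 p) = h' (T2 p) -> h (T3 p) = h' (T3 p) -> h =1 h'.
Proof.
move=> e1 e2 e3; elim/mpoly3_ind => //; first by rewrite !rmorph1.
  by move=> F G; rewrite !rmorphD => -> ->.
by move=> F G; rewrite !rmorphM => -> ->.
Qed.

End Polynomials.

(** * The coordinate ring of T *)

Local Notation "F %:OT" := (@OT_of_poly _ F) (at level 2, format "F %:OT").

Section CoordinateRing.
Variable p : nat.
Hypothesis p_pr : prime p.
Local Notation S := {mpoly 'F_p[3]}.
Local Notation A := (OT p).

Lemma OT_of_poly_zmod_morphism : zmod_morphism (@OT_of_poly p).
Proof. by move=> F G; apply: val_inj; rewrite /= tofracB. Qed.
Lemma OT_of_poly_monoid_morphism : monoid_morphism (@OT_of_poly p).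
Proof. by split=> [|F G]; apply: val_inj; rewrite /= ?tofrac1 ?tofracM. Qed.
HB.instance Definition _ :=
  GRing.isZmodMorphism.Build S A (@OT_of_poly p) OT_of_poly_zmod_morphism.
HB.instance Definition _ :=
  GRing.isMonoidMorphism.Build S A (@OT_of_poly p) OT_of_poly_monoid_morphism.

Lemma OT_of_polyD (F G : S) : (F + G)%:OT = F%:OT + G%:OT. Proof. exact: rmorphD. Qed.
Lemma OT_of_polyM (F G : S) : (F * G)%:OT = F%:OT * G%:OT. Proof. exact: rmorphM. Qed.
Lemma OT_of_polyX (F : S) m : (F ^+ m)%:OT = F%:OT ^+ m. Proof. exact: rmorphXn. Qed.

Lemma OT_of_poly_inj : injective (@OT_of_poly p).
Proof. by move=> F G /(congr1 val) /= /eqP; rewrite tofrac_eq => /eqP. Qed.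

Lemma Delta_inv_subproof : (Delta p)%:F^-1 \in @in_OT p.
Proof. by apply/asboolP; exists 1, 1%N; rewrite tofrac1 div1r expr1. Qed.

Definition Delta_inv : A := MkOT Delta_inv_subproof.

Lemma Delta_invK : Delta_inv * (Delta p)%:OT = 1.
Proof.
apply: val_inj => /=; rewrite mulVf // tofrac_eq0; exact: Delta_neq0.
Qed.

Lemma OT_clear_denominator (a : A) : exists (F : S) k, a * (Delta p)%:OT ^+ k = F%:OT.
Proof.
have /asboolP[F [k aE]] := valP a.
exists F, k; apply: val_inj.
by rewrite rmorphM rmorphXn /= -[OTval a]/(val a) aE mulfVK // DeltaF_neq0.
Qed.

Lemma OT_eqP (a b : A) k : a * (Delta p)%:OT ^+ k = b * (Delta p)%:OT ^+ k -> a = b.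
Proof.
move/(congr1 (fun x => x * Delta_inv ^+ k)).
by rewrite -!mulrA -!exprMn ![_%:OT * _]mulrC Delta_invK expr1n !mulr1.
Qed.

Lemma OT_ind (P : A -> Prop) : P 1 ->
  (forall a b, P a -> P b -> P (a + b)) -> (forall a b, P a -> P b -> P (a * b)) ->
  P (T1 p)%:OT -> P (T2 p)%:OT -> P (T3 p)%:OT -> P Delta_inv -> forall a, P a.
Proof.
move=> P1 PD PM PT1 PT2 PT3 PV a.
have [F [k aE]] := OT_clear_denominator a.
have -> : a = F%:OT * Delta_inv ^+ k.
  by rewrite -aE -mulrA -exprMn mulrC [_%:OT * _]mulrC Delta_invK expr1n mul1r.
apply: (PM).
  elim/(mpoly3_ind p_pr) : F {aE} => //; first by rewrite rmorph1.
    by move=> F G PF PG; rewrite rmorphD; apply: (PD).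
  by move=> F G PF PG; rewrite rmorphM; apply: (PM).
by elim: k {aE} => [|k IH]; rewrite ?expr0 // exprS; apply: (PM).
Qed.

Lemma ramanujan_poly_derivation : derivation (@ramanujan_poly p).
Proof.
split; last exact: ramanujan_polyM.
by move=> F G; rewrite /ramanujan_poly !mderivD; ring.
Qed.

Lemma ramanujan_derivation : derivation (@ramanujan p).
Proof.
have [dD dM] := frac_der_derivation ramanujan_poly_derivation.
by split=> a b; apply: val_inj; rewrite /= ?dD ?dM.
Qed.

Lemma ramanujan_OT_of_poly (F : S) : ramanujan F%:OT = (ramanujan_poly F)%:OT.
Proof. by apply: val_inj; exact: (frac_der_tofrac ramanujan_poly_derivation). Qed.

Lemma mderivXU (i j : 'I_3) : ('X_i : S)^`M(j) = (i == j)%:R.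
Proof.
rewrite mderivX mnm1E; case: eqP => [->|_]; last by rewrite scale0r.
rewrite (_ : (U_(j) - U_(j))%MM = 0%MM) ?mpolyX0 ?scale1r //.
by apply/mnmP=> k; rewrite mnmBE subnn mnmE.
Qed.

Lemma inord3_eq m m' : (m < 3)%N -> (m' < 3)%N ->
  ((inord m : 'I_3) == inord m') = (m == m').
Proof. by move=> *; rewrite -val_eqE /= !inordK. Qed.

Lemma ramanujan_polyT1 : ramanujan_poly (T1 p) = T1 p ^+ 2 - 12%:R^-1 *: T2 p.
Proof. by rewrite /ramanujan_poly !(mderivXU (inord 0)) !inord3_eq //=; ring. Qed.

Lemma ramanujan_polyT2 :
  ramanujan_poly (T2 p) = 4%:R * T1 p * T2 p - 6%:R * T3 p.
Proof. by rewrite /ramanujan_poly !(mderivXU (inord 1)) !inord3_eq //=; ring. Qed.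

Lemma ramanujan_polyT3 :
  ramanujan_poly (T3 p) = 6%:R * T1 p * T3 p - 3%:R^-1 *: T2 p ^+ 2.
Proof. by rewrite /ramanujan_poly !(mderivXU (inord 2)) !inord3_eq //=; ring. Qed.

End CoordinateRing.

(** * The invariant curve *)

Section Curve.
Variable p : nat.
Hypotheses (p_pr : prime p) (p_neq2 : p != 2%N) (p_neq3 : p != 3%N).
Local Notation S := {mpoly 'F_p[3]}.
Local Notation A := (OT p).
Local Notation n := p./2.
Local Notation T1 := (T1 p).
Local Notation T2 := (T2 p).
Local Notation T3 := (T3 p).
Local Notation Delta := (Delta p).

Lemma pchar_doubleS : n.*2.+1 = p.
Proof.
rewrite -[RHS]odd_double_half; case/even_prime: p_pr => [p2|-> //].
by case/eqP: p_neq2.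
Qed.

Lemma half_pchar_gt1 : (1 < n)%N.
Proof.
have := pchar_doubleS; case: n => [|[|//]] pE; first by have := p_pr; rewrite -pE.
by case/eqP: p_neq3.
Qed.

Lemma pcharS_double : n.*2.+1 \in [pchar S].
Proof. by rewrite pchar_doubleS pcharS. Qed.

Lemma Fp_natr_neq0 m : (0 < m < 5)%N -> m%:R != 0 :> 'F_p.
Proof.
have charF : n.*2.+1 \in [pchar 'F_p] by rewrite pchar_doubleS pchar_Fp.
exact: natr_small_neq0 charF half_pchar_gt1 _.
Qed.

Lemma Fp_12 : 12%:R != 0 :> 'F_p.
Proof. by rewrite (natrM _ 3 4) mulf_neq0 ?Fp_natr_neq0. Qed.

Definition hasseT : S := hasse n T2 T3.
Definition cohasseT : S := cohasse n T2 T3.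

Lemma natr_mul_scale m (c : 'F_p) (F : S) : m%:R * (c *: F) = (m%:R * c) *: F.
Proof. by rewrite mulr_natl -scaler_nat scalerA. Qed.

Lemma scale_natr_mul m (c : 'F_p) (F : S) : c *: (m%:R * F) = (c * m%:R) *: F.
Proof. by rewrite mulr_natl -scaler_nat scalerA. Qed.

(** The equations A = 1 and t1 + B = 0 of the curve, locked because unification
    would otherwise expand their n-th power. *)
Definition eqnA : S := locked (hasseT - 1).
Definition eqnB : S := locked (T1 + cohasseT).
Lemma eqnAE : eqnA = hasseT - 1. Proof. by rewrite /eqnA -lock. Qed.
Lemma eqnBE : eqnB = T1 + cohasseT. Proof. by rewrite /eqnB -lock. Qed.

Lemma ramanujan_hasse_hyps :
  [/\ ramanujan_poly T2 = 4%:R * T1 * T2 - 6%:R * 1 * T3 &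
      3%:R * ramanujan_poly T3 = 18%:R * T1 * T3 - 1 * T2 ^+ 2].
Proof.
split; first by rewrite ramanujan_polyT2; ring.
rewrite ramanujan_polyT3 mulrBr natr_mul_scale.
by rewrite divff ?Fp_natr_neq0 // scale1r; ring.
Qed.

Lemma ramanujan_eqnA : ramanujan_poly eqnA = - T1 * eqnA - eqnB.
Proof.
have derv := @ramanujan_poly_derivation p; have [v2 v3] := ramanujan_hasse_hyps.
rewrite eqnAE eqnBE (derB derv) (der1 derv) subr0 /hasseT.
rewrite (der_hasse pcharS_double half_pchar_gt1 derv v2 v3).
by rewrite /cohasseT; ring.
Qed.

Lemma ramanujan_eqnB :
  ramanujan_poly eqnB = (12%:R^-1 *: T2) * eqnA + T1 * eqnB.
Proof.
have derv := @ramanujan_poly_derivation p; have [v2 v3] := ramanujan_hasse_hyps.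
rewrite eqnAE eqnBE derv.1 ramanujan_polyT1.
have -> : ramanujan_poly cohasseT = T1 * cohasseT + 12%:R^-1 *: (T2 * hasseT).
  have := der_cohasse pcharS_double half_pchar_gt1 derv v2 v3.
  move/(congr1 (fun F => 12%:R^-1 *: F)); rewrite -/cohasseT -/hasseT.
  rewrite mul1r -mulrA scalerDr !scale_natr_mul mulVf ?Fp_12 //.
  by rewrite !scale1r.
by rewrite mulrBr mulr1 scalerAl; ring.
Qed.

(** Twice the Euler field for the weights 2 of t2 and 3 of t3. *)
Definition euler_poly (F : S) : S :=
  \sum_(i < 3) [:: 0; 4%:R * T2; 6%:R * T3]`_i * F^`M(i).

Lemma euler_derivation : derivation euler_poly.
Proof. exact: (mderiv_comb_derivation (fun i : 'I_3 => [:: 0; _; _]`_i)). Qed.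

(** A is homogeneous of weight n and 2 n = - 1 modulo p. *)
Lemma euler_eqnA : euler_poly eqnA = - (eqnA + 1).
Proof.
have derE := euler_derivation.
have E2 : euler_poly T2 = 4%:R * 1 * T2 - 6%:R * 0 * T3.
  rewrite /euler_poly !big_ord_recl big_ord0 /= /Defs.T2 !mderivXU.
  rewrite -!val_eqE /= !inordK //=.
  by rewrite !mulr0 mulr1 add0r !addr0; ring.
have E3 : 3%:R * euler_poly T3 = 18%:R * 1 * T3 - 0 * T2 ^+ 2.
  rewrite /euler_poly !big_ord_recl big_ord0 /= /Defs.T3 !mderivXU.
  rewrite -!val_eqE /= !inordK //=.
  by rewrite !mulr0 mulr1 !add0r !addr0; ring.
rewrite eqnAE (derB derE) (der1 derE) subr0 /hasseT.
rewrite (der_hasse pcharS_double half_pchar_gt1 derE E2 E3).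
by rewrite mul0r subr0 mul1r subrK.
Qed.

Definition curve : {pred A} :=
  fun a => `[< exists b c : A, a = b * eqnA%:OT + c * eqnB%:OT >].

Lemma curveP (a : A) :
  reflect (exists b c : A, a = b * eqnA%:OT + c * eqnB%:OT) (a \in curve).
Proof. exact: asboolP. Qed.

Lemma curve_combination (R : comNzRingType) (b c b' c' t r f g : R) :
  b' * f + b * (- t * f - g) + (c' * g + c * (r * f + t * g)) =
  (b' + b * - t + c * r) * f + (c' - b + c * t) * g.
Proof. by ring. Qed.

Lemma clear_denominators (R : comNzRingType) (b c f g x y z : R) :
  y * z * ((b * f + c * g) * x) = x * (b * y * z * f + c * z * y * g).
Proof. by ring. Qed.

Lemma factor_denominator (R : comNzRingType) (x y v d f g : R) :
  (x * v * f + y * v * g) * d = (x * f + y * g) * (v * d).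
Proof. by ring. Qed.

Lemma curve_invariant : invariant_ideal (@ramanujan p) curve.
Proof.
rewrite /curve => _ /curveP[b [c ->]]; have derv := @ramanujan_derivation p.
rewrite derv.1 !derv.2 !ramanujan_OT_of_poly ramanujan_eqnA ramanujan_eqnB.
rewrite (rmorphB _ (_ * _)) (rmorphD _ (_ * _)) !(rmorphM _ _ eqnA).
rewrite (rmorphM _ _ eqnB) rmorphN /=.
by apply/asboolP; do 2!eexists; apply: curve_combination.
Qed.

(** ** Reducedness *)

Lemma eqnA_neq0 : eqnA != 0.
Proof.
apply/eqP=> f0; have := euler_eqnA; rewrite f0 /euler_poly.
rewrite [LHS]big1 => [/esym/eqP|i _]; last by rewrite mderiv0 mulr0.
by rewrite add0r oppr_eq0 oner_eq0.
Qed.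

(** Derivations kill F ^+ p, and the Euler field maps f = A - 1 to a unit modulo
    f; applying it repeatedly shows that f ^+ p divides F ^+ p.  The cofactor has
    zero derivatives, hence is a p-th power. *)
Lemma eqnA_pth_root (F w : S) : F ^+ p = eqnA * w -> exists G, F = eqnA * G.
Proof.
have derE := euler_derivation.
have charS := pcharS p_pr.
have f0 := eqnA_neq0.
move=> Fw; have step i : (0 < i <= p)%N -> exists w', F ^+ p = eqnA ^+ i * w'.
  elim: i => // -[_ _|i IH /andP[_ i_lt]]; first by exists w; rewrite expr1.
  have [|w' Fw'] := IH; first exact: ltnW.
  have i1 : i.+1%:R != 0 :> 'F_p.
    by rewrite -(dvdn_pcharf (pchar_Fp p_pr)); apply/negP => /dvdn_leq; lia.
  have : euler_poly (F ^+ p) = 0.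
    by rewrite (derX derE) (pcharf0 charS) !mul0r.
  rewrite Fw' derE.2 (derX derE) euler_eqnA /= => ew.
  have /eqP : eqnA ^+ i * (- i.+1%:R * (eqnA + 1) * w' + eqnA * euler_poly w') = 0.
    by rewrite -[RHS]ew exprS; ring.
  rewrite mulf_eq0 expf_eq0 (negbTE f0) andbF /= => /eqP ew'.
  have iw : i.+1%:R * w' = eqnA * (euler_poly w' - i.+1%:R * w').
    by apply/eqP; rewrite -subr_eq0 -oppr_eq0 -[X in _ == X]ew'; apply/eqP; ring.
  exists (i.+1%:R^-1 *: (euler_poly w' - i.+1%:R * w')).
  rewrite [eqnA ^+ i.+2]exprSr -mulrA -scalerAr -iw; congr (_ * _).
  by rewrite scale_natr_mul mulVf // scale1r.
have [|{}w {}Fw] := step p; first by rewrite prime_gt0 /=.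
have [i|G wG] := mpoly_pth_power p_pr (F := w).
  have derd := mderiv_comb_derivation (fun j : 'I_3 => (i == j)%:R : S).
  have dE (G : S) : \sum_j (i == j)%:R * G^`M(j) = G^`M(i).
    rewrite (bigD1 i) //= eqxx mul1r big1 ?addr0 // => j ji.
    by rewrite eq_sym (negbTE ji) mul0r.
  have := derX derd F p; rewrite Fw derd.2 (derX derd) (pcharf0 charS) !mul0r add0r.
  by rewrite dE => /eqP; rewrite mulf_eq0 expf_eq0 (negbTE f0) andbF => /eqP.
have Xp0 (H : S) : H ^+ p = 0 -> H = 0.
  by move/eqP; rewrite expf_eq0 => /andP[_ /eqP].
exists G; apply/eqP; rewrite -subr_eq0; apply/eqP/Xp0.
rewrite -(pFrobenius_autE charS) pFrobenius_autB_comm; last exact: mulrC.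
by rewrite !pFrobenius_autE Fw wG exprMn subrr.
Qed.

Lemma eqnA_radical (F w : S) m : F ^+ m = eqnA * w -> exists G, F = eqnA * G.
Proof.
move=> Fm; suff pow e : forall H w', H ^+ (p ^ e) = eqnA * w' -> exists G, H = eqnA * G.
  apply: (pow m F (F ^+ (p ^ m - m) * w)).
  rewrite mulrCA -Fm -exprD subnK // ltnW // ltn_expl //; exact: prime_gt1.
elim: e => [|e IH] H w'; first by rewrite expr1; exists w'.
by rewrite expnS mulnC exprM => /eqnA_pth_root[G /IH].
Qed.

(** Restriction to the graph t1 = - B over the (t2, t3)-plane. *)
Definition elim1 : S -> S := ev_at (@mpolyC 3 'F_p) (- cohasseT) T2 T3.
HB.instance Definition _ := GRing.RMorphism.copy elim1
  (ev_at (@mpolyC 3 'F_p) (- cohasseT) T2 T3).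

Lemma elim1D F G : elim1 (F + G) = elim1 F + elim1 G. Proof. exact: rmorphD. Qed.
Lemma elim1M F G : elim1 (F * G) = elim1 F * elim1 G. Proof. exact: rmorphM. Qed.
Lemma elim1X F m : elim1 (F ^+ m) = elim1 F ^+ m. Proof. exact: rmorphXn. Qed.
Lemma elim1_T2 : elim1 T2 = T2. Proof. exact: ev_atT2. Qed.
Lemma elim1_T3 : elim1 T3 = T3. Proof. exact: ev_atT3. Qed.

Lemma elim1_eqnA : elim1 eqnA = eqnA.
Proof. by rewrite eqnAE rmorphB rmorph1 rmorph_hasse /= elim1_T2 elim1_T3. Qed.

Lemma elim1_eqnB : elim1 eqnB = 0.
Proof.
by rewrite eqnBE rmorphD rmorph_cohasse /= elim1_T2 elim1_T3 [elim1 T1]ev_atT1 addNr.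
Qed.

Lemma elim1_Delta : elim1 Delta = Delta.
Proof.
by rewrite /Defs.Delta rmorphB rmorphM !rmorphXn rmorph_nat /= elim1_T2 elim1_T3.
Qed.

Lemma elim1_mod F : exists G, F = elim1 F + G * eqnB.
Proof.
elim/(mpoly3_ind p_pr): F => [|F F' [G {1}->] [G' {1}->]|F F' [G {1}->] [G' {1}->]|||].
- by exists 0; rewrite rmorph1 mul0r addr0.
- exists (G + G'); rewrite elim1D; move: (elim1 F) (elim1 F') eqnB => x y g.
  by ring.
- exists (G * elim1 F' + elim1 F * G' + G * G' * eqnB).
  by rewrite elim1M; move: (elim1 F) (elim1 F') eqnB => x y g; ring.
- by exists 1; rewrite [elim1 _]ev_atT1 eqnBE mul1r addrC addrK.
- by exists 0; rewrite elim1_T2 mul0r addr0.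
- by exists 0; rewrite elim1_T3 mul0r addr0.
Qed.

(** Projected to the (t2, t3)-plane, the curve is A = 1 minus the points where
    Delta = 0. *)
Lemma mem_curveP (a : A) F k : a * Delta%:OT ^+ k = F%:OT ->
  (a \in curve) <-> (exists j G, Delta ^+ j * elim1 F = eqnA * G).
Proof.
move=> aF; split=> [/curveP[b [c aE]]|[j [G FG]]].
  have [Fb [kb bE]] := OT_clear_denominator b.
  have [Fc [kc cE]] := OT_clear_denominator c.
  have : Delta ^+ (kb + kc) * F =
    Delta ^+ k * (Fb * Delta ^+ kc * eqnA + Fc * Delta ^+ kb * eqnB).
    apply: (@OT_of_poly_inj p).
    rewrite !OT_of_polyM (OT_of_polyD (_ * _)) !OT_of_polyM !OT_of_polyX.
    rewrite -aF aE -bE -cE exprD.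
    exact: clear_denominators.
  move/(congr1 elim1); rewrite !elim1M (elim1D (_ * _)) !elim1M !elim1X.
  rewrite elim1_eqnA elim1_eqnB elim1_Delta.
  move: (elim1 F) (elim1 Fb) (elim1 Fc) => x y z; rewrite mulr0 addr0 => FE.
  by exists (kb + kc)%N; eexists; rewrite FE mulrA mulrC.
have [H FH] := elim1_mod F.
apply/curveP.
have : (Delta ^+ j * F) = G * eqnA + Delta ^+ j * H * eqnB.
  by rewrite FH mulrDr FG; move: eqnA eqnB => f g; ring.
move/(congr1 (@OT_of_poly p)).
rewrite OT_of_polyM (OT_of_polyD (_ * _)) !OT_of_polyM OT_of_polyX -aF => aE.
exists (G%:OT * @Delta_inv p ^+ (j + k)),
  (Delta%:OT ^+ j * H%:OT * @Delta_inv p ^+ (j + k)).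
apply: (@OT_eqP _ _ _ (j + k)).
rewrite factor_denominator -exprMn Delta_invK expr1n mulr1 exprD.
by rewrite -aE mulrCA.
Qed.

Lemma curve_radical : radical_ideal curve.
Proof.
move=> a m; have [F [k aF]] := OT_clear_denominator a.
have amF : a ^+ m * Delta%:OT ^+ (k * m) = (F ^+ m)%:OT.
  by rewrite exprM -exprMn aF rmorphXn.
case/(mem_curveP amF) => j [G FG]; apply/(mem_curveP aF).
have /eqnA_radical[H FH] : (Delta ^+ j * elim1 F) ^+ m.+1 =
    eqnA * (G * Delta ^+ (j * m) * elim1 F).
  rewrite mulrA mulrA -FG elim1X exprMn exprSr exprS -exprM.
  by move: eqnA => f; ring.
by exists j, H.
Qed.

End Curve.

(** ** Nonemptiness *)

Section CurveProper.
Variable p : nat.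
Hypotheses (p_pr : prime p) (p_neq2 : p != 2%N) (p_neq3 : p != 3%N).
Local Notation S := {mpoly 'F_p[3]}.
Local Notation n := p./2.

Lemma hasseT_neq0 : hasseT p != 0.
Proof.
have charF : n.*2.+1 \in [pchar 'F_p] by rewrite pchar_doubleS ?pchar_Fp.
apply/eqP => /(congr1 (ev_at idfun 0 (12%:R : 'F_p) (- 8%:R))).
rewrite rmorph0 rmorph_hasse /= ev_atT2 ev_atT3 hasse_nodal // => /eqP.
by rewrite expf_eq0 (negbTE (Fp_12 _ _ _)) // andbF.
Qed.

(** The divisors of a monomial are monomials: at a nonzero constant term of the
    first factor, X divides the second and can be cancelled. *)
Lemma scaled_eqn_not_monomial (R : idomainType) (c d : R) m k (w : {poly R}) :
  c != 0 -> d != 0 -> (0 < m)%N -> ('X^m * c%:P - 1) * w != 'X^k * d%:P.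
Proof.
move=> c0 d0 m0; have szl : size ('X^m * c%:P - 1 : {poly R}) = m.+1.
  have szX : size ('X^m * c%:P : {poly R}) = m.+1.
    by rewrite mulrC size_Cmul ?size_polyXn.
  by rewrite size_polyDl ?szX // size_polyN size_poly1.
elim: k w => [|k IH] w; apply/eqP => e.
  have dC : 'X^0 * d%:P = d%:P :> {poly R} by rewrite expr0 mul1r.
  have w0 : w != 0.
    by apply: contraNneq d0 => w0; rewrite -polyC_eq0 -dC -e w0 mulr0.
  have := congr1 (fun q : {poly R} => size q) e.
  rewrite dC size_polyC d0 size_mul ?szl // -?size_poly_gt0 ?szl //=.
  move: w0; rewrite -size_poly_gt0; case: (size w) => // s _.
  move: m0; case: (m) => // m' _.
  by rewrite addSn addnS.
have /eqP : (('X^m * c%:P - 1) * w).[0] = 0.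
  by rewrite e exprS -mulrA hornerM hornerX mul0r.
rewrite hornerM !hornerE expr0n eqn0Ngt m0 /= mul0r sub0r mulN1r oppr_eq0.
rewrite -rootE => /factor_theorem[w' w'E].
have X0 : 'X != 0 :> {poly R} by rewrite polyX_eq0.
have /eqP := IH w'; apply; apply: (mulfI X0).
transitivity (('X^m * c%:P - 1) * w); last by rewrite e exprS mulrA.
by rewrite w'E subr0; ring.
Qed.

(** Scaling t2 and t3 according to their weights by a new variable Z turns A - 1
    into Z^n A - 1 and Delta into the monomial Z^6 Delta. *)
Lemma Delta_pow_notin_eqnA j (w : S) : Delta p ^+ j != eqnA p * w.
Proof.
apply/eqP=> e; pose h : {rmorphism S -> {poly S}} :=
  ev_at (polyC \o @mpolyC 3 'F_p) 0 ('X^2 * (T2 p)%:P) ('X^3 * (T3 p)%:P).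
have hD : h (Delta p) = 'X^6 * (Delta p)%:P.
  rewrite /Delta rmorphB rmorphM !rmorphXn rmorph_nat /= ev_atT2 ev_atT3.
  rewrite rmorphB rmorphM !rmorphXn rmorph_nat /=; ring.
have hA : h (eqnA p) = 'X^n * (hasseT p)%:P - 1.
  rewrite eqnAE rmorphB rmorph1 /hasseT rmorph_hasse /= ev_atT2 ev_atT3.
  by rewrite hasse_scale ?polyX_eq0 // rmorph_hasse.
have := congr1 h e; rewrite rmorphM rmorphXn hA hD exprMn -exprM -polyC_exp.
apply/eqP; rewrite eq_sym scaled_eqn_not_monomial ?hasseT_neq0 ?expf_neq0 //;
  first exact: Delta_neq0.
by apply: ltnW; apply: half_pchar_gt1.
Qed.

Lemma curve_idealr_closed : idealr_closed (@curve p).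
Proof.
split.
- by apply/curveP; exists 0, 0; rewrite !mul0r addr0.
- have one : 1 * (Delta p)%:OT ^+ 0 = (1 : S)%:OT by rewrite mulr1 rmorph1.
  apply/negP => /(mem_curveP p_pr one)[j [G /eqP]].
  by rewrite rmorph1 mulr1; apply/negP/Delta_pow_notin_eqnA.
move=> a _ _ /curveP[b [c ->]] /curveP[b' [c' ->]]; apply/curveP.
exists (a * b + b'), (a * c + c').
by rewrite mulrDr !mulrDl !mulrA addrACA.
Qed.

End CurveProper.

(** * Algebraic dependence by counting *)

Section Bidegree.
Variable F : idomainType.
Implicit Types w z : {poly {poly F}}.

Definition bidegree_le d w := (size w <= d.+1)%N && (size (swapXY w) <= d.+1)%N.

Lemma bidegree_leW d e w : (d <= e)%N -> bidegree_le d w -> bidegree_le e w.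
Proof.
move=> de /andP[wx wy].
by apply/andP; split; [exact: leq_trans wx _ | exact: leq_trans wy _].
Qed.

Lemma bidegree_leM d e w z :
  bidegree_le d w -> bidegree_le e z -> bidegree_le (d + e) (w * z).
Proof.
have sizeM (u v : {poly {poly F}}) : (size u <= d.+1)%N -> (size v <= e.+1)%N ->
    (size (u * v)%R <= (d + e).+1)%N.
  by move=> ud ve; have := size_polyMleq u v; lia.
by move=> /andP[wx wy] /andP[zx zy]; rewrite /bidegree_le rmorphM !sizeM.
Qed.

Lemma bidegree_le1 d : bidegree_le d 1.
Proof. by apply/andP; rewrite (rmorph1 (@swapXY F)) size_poly1. Qed.

Lemma bidegree_leX d w i : bidegree_le d w -> bidegree_le (d * i) (w ^+ i).
Proof.
move=> wd; elim: i => [|i IH]; first exact: bidegree_le1.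
by rewrite exprS mulnS bidegree_leM.
Qed.

Lemma bidegree_leD d w z : bidegree_le d w -> bidegree_le d z -> bidegree_le d (w + z).
Proof.
move=> /andP[wx wy] /andP[zx zy]; apply/andP; rewrite rmorphD.
by split; apply: leq_trans (size_polyD _ _) _; rewrite geq_max ?wx ?wy.
Qed.

Lemma bidegree_leB d w z : bidegree_le d w -> bidegree_le d z -> bidegree_le d (w - z).
Proof.
move=> wd /andP[zx zy]; apply: bidegree_leD => //.
have swapN : swapXY (- z) = - swapXY z by exact: raddfN.
by apply/andP; rewrite swapN (size_polyN z) (size_polyN (swapXY z)).
Qed.

Lemma bidegree_le0 d : bidegree_le d 0.
Proof. by rewrite /bidegree_le rmorph0 size_poly0. Qed.

Lemma bidegree_le_sum d (I : Type) (r : seq I) (P : pred I) (f : I -> {poly {poly F}}) :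
  (forall i, P i -> bidegree_le d (f i)) -> bidegree_le d (\sum_(i <- r | P i) f i).
Proof.
by move=> fd; elim/big_ind: _ => //; [exact: bidegree_le0 | exact: bidegree_leD].
Qed.

Lemma bidegree_leC d c : bidegree_le d c%:P%:P.
Proof.
by apply/andP; rewrite swapXY_polyC map_polyC; split;
  apply: leq_trans (size_polyC_leq1 _) _.
Qed.

Lemma bidegree_coef_gt d w i j :
  bidegree_le d w -> (d < i)%N || (d < j)%N -> w`_i`_j = 0.
Proof.
move=> /andP[wx wy] /orP[di|dj].
  by rewrite [w`_i]nth_default ?coef0 ?(leq_trans wx).
by rewrite -coef_swapXY [_`_j]nth_default ?coef0 ?(leq_trans wy).
Qed.

Lemma bidegree_ex w : exists d, bidegree_le d w.
Proof.
exists (size w + size (swapXY w))%N.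
by rewrite /bidegree_le !leqW ?leq_addr ?leq_addl.
Qed.

End Bidegree.

Section Dependence.
Variable F : finFieldType.
Local Notation W := {poly {poly F}}.

Definition bipoly N (q : {ffun 'I_N.+1 * 'I_N.+1 -> F}) : W :=
  \poly_(i < N.+1) \poly_(j < N.+1) q (inord i, inord j).

Lemma coef_bipoly N (q : {ffun 'I_N.+1 * 'I_N.+1 -> F}) (i j : 'I_N.+1) :
  (bipoly q)`_i`_j = q (i, j).
Proof. by rewrite coef_poly ltn_ord coef_poly ltn_ord !inord_val. Qed.

Lemma bipolyB N : {morph @bipoly N : q r / q - r}.
Proof.
move=> q r; apply/polyP=> i; apply/polyP=> j; rewrite !coefB !coef_poly.
case: ifP => _; last by rewrite !coef0 subrr.
by rewrite !coef_poly; case: ifP => _; rewrite ?subrr // !ffunE.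
Qed.

Lemma bipoly_eq0 N (q : {ffun 'I_N.+1 * 'I_N.+1 -> F}) : bipoly q = 0 -> q = 0.
Proof.
by move=> q0; apply/ffunP=> -[i j]; rewrite -coef_bipoly q0 !coef0 ffunE.
Qed.

Lemma bidegree_bipoly N (q : {ffun 'I_N.+1 * 'I_N.+1 -> F}) : bidegree_le N (bipoly q).
Proof.
rewrite /bidegree_le size_poly -sizeYE; apply/bigmax_leqP => i _.
by rewrite coef_poly; case: ifP; rewrite ?size_poly0 ?size_poly.
Qed.

(** The polynomials q of degree at most N in each of two variables, evaluated at
    the fractions u / x^k and v / x^k with the denominator cleared, have bidegree
    at most M, where M grows linearly with N; so do the multiples f r with r of
    bidegree at most M - d.  For large N the pairs (q, r) outnumber the
    polynomials of bidegree at most M, because (N + 1)^2 exceeds the codimension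
    (M + 1)^2 - (M - d + 1)^2, which is linear in M. *)
Lemma dependence_modulo (u v x f : W) k : f != 0 -> exists N q r,
  bipoly q != 0 :> W /\
  \sum_(ij : 'I_N.+1 * 'I_N.+1)
     (q ij)%:P%:P * (u ^+ ij.1 * v ^+ ij.2 * x ^+ (k * (N - ij.1 + (N - ij.2))))
  = f * r.
Proof.
move=> f0.
have [du ud] := bidegree_ex u; have [dv vd] := bidegree_ex v.
have [dx xd] := bidegree_ex x; have [df fd] := bidegree_ex f.
(* A common bound, positive in order that N be large. *)
pose d := (du + dv + dx + df).+1.
have {}ud : bidegree_le d u by apply: bidegree_leW ud; lia.
have {}vd : bidegree_le d v by apply: bidegree_leW vd; lia.
have {}xd : bidegree_le d x by apply: bidegree_leW xd; lia.
have {}fd : bidegree_le d f by apply: bidegree_leW fd; lia.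
have d_gt0 : (0 < d)%N by [].
move: (d) d_gt0 ud vd xd fd => {du dv dx df} {}d d_gt0 ud vd xd fd.
(* The bidegree of a homogenized monomial is at most d (2 N + 2 k N) = e N, and
   N * N >= 2 d (M + 1) is what the count below needs. *)
pose e := (2 * d * k.+1)%N; pose N := (2 * d * e.+1)%N.
pose M := (e * N)%N; pose L := (M - d)%N.
have dM : (d <= M)%N by rewrite /M /N /e; nia.
pose T := ({ffun 'I_N.+1 * 'I_N.+1 -> F} * {ffun 'I_L.+1 * 'I_L.+1 -> F})%type.
pose form (q : {ffun 'I_N.+1 * 'I_N.+1 -> F}) :=
  \sum_(ij : 'I_N.+1 * 'I_N.+1)
     (q ij)%:P%:P * (u ^+ ij.1 * v ^+ ij.2 * x ^+ (k * (N - ij.1 + (N - ij.2)))).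
have formB q q' : form (q - q') = form q - form q'.
  rewrite /form -sumrB; apply: eq_bigr => ij _.
  by rewrite !ffunE !polyCB mulrBl.
pose Phi (t : T) : W := form t.1 - f * bipoly t.2.
have Phi_bideg t : bidegree_le M (Phi t).
  apply: bidegree_leB; last first.
    apply: bidegree_leW (bidegree_leM fd (bidegree_bipoly _)).
    by rewrite /L subnKC.
  apply: bidegree_le_sum => -[i j] _ /=.
  apply: bidegree_leW (bidegree_leM (bidegree_leC 0 _)
    (bidegree_leM (bidegree_leM (bidegree_leX i ud) (bidegree_leX j vd))
      (bidegree_leX _ xd))).
  have := ltn_ord i; have := ltn_ord j; rewrite !ltnS add0n => jN iN.
  have exps : (i + j + k * (N - i + (N - j)) <= 2 * k.+1 * N)%N.
    have /(leq_mul (leqnn k)) : (N - i + (N - j) <= N + N)%N.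
      by rewrite leq_add ?leq_subr.
    by move: (k * (_ - _ + _))%N => K; rewrite mulnS mulnDl -mulnA addnn -muln2; nia.
  by rewrite -!mulnDr /M /e [(2 * d)%N]mulnC -!mulnA leq_mul2l mulnA exps orbT.
pose psi (t : T) : {ffun 'I_M.+1 * 'I_M.+1 -> F} :=
  [ffun ij : 'I_M.+1 * 'I_M.+1 => (Phi t)`_(ij.1)`_(ij.2)].
have /injectivePn[t [t' tt' psitt']] : ~~ injectiveb psi.
  apply/negP => /injectiveP/leq_card.
  rewrite card_prod !card_ffun !card_prod !card_ord -expnD leqNgt.
  move/negP; apply; rewrite ltn_exp2l; last exact: card_finNzRing_gt1.
  have dN : (2 * d * (e * N).+1 <= N * N)%N.
    have N0 : (0 < N)%N by rewrite /N; nia.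
    have -> : (N * N = 2 * d * (e.+1 * N))%N by rewrite mulnA.
    by rewrite leq_mul2l (mulSn e) -[(e * N).+1]add1n leq_add2r N0 orbT.
  have ML : M = (d + L)%N by rewrite /L subnKC.
  move: dN; rewrite -/M ML; move: (L) (N) => l m dN.
  have sq : ((d + l).+1 * (d + l).+1 + d * d =
      l.+1 * l.+1 + 2 * d * (d + l).+1)%N by lia.
  apply: (@leq_ltn_trans (l.+1 * l.+1 + m * m)%N); last by rewrite addnC ltn_add2r; lia.
  by rewrite (leq_trans (leq_addr (d * d) _)) // sq leq_add2l.
have PhiE : Phi t = Phi t'.
  apply/polyP=> i; apply/polyP=> j.
  have [lti|gti] := ltnP M i.
    by rewrite !(bidegree_coef_gt (Phi_bideg _)) ?lti.
  have [ltj|gtj] := ltnP M j.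
    by rewrite !(bidegree_coef_gt (Phi_bideg _)) ?ltj ?orbT.
  have := congr1 (fun g : {ffun _ -> F} => g (inord i, inord j)) psitt'.
  by rewrite !ffunE /= !inordK.
exists N, (t.1 - t'.1), (bipoly t.2 - bipoly t'.2); split; last first.
  rewrite -/(form _) formB mulrBr; apply/eqP; rewrite -subr_eq0; apply/eqP.
  by move/eqP: PhiE; rewrite -subr_eq0 /Phi => /eqP <-; ring.
apply: contra_neq tt' => /bipoly_eq0 /eqP; rewrite subr_eq0 => /eqP e1.
have : f * (bipoly t.2 - bipoly t'.2) = 0.
  move/eqP: PhiE; rewrite /Phi e1 -subr_eq0 => /eqP PhiE.
  by rewrite -[RHS]oppr0 -PhiE; ring.
move/eqP; rewrite mulf_eq0 (negbTE f0) -bipolyB => /eqP/bipoly_eq0/eqP.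
rewrite subr_eq0 => /eqP e2.
by rewrite (surjective_pairing t) (surjective_pairing t') e1 e2.
Qed.

End Dependence.

Section Evaluation.
Variables (F R : comNzRingType) (g : {rmorphism F -> R}) (x y : R).

Definition ev1 : {poly F} -> R := horner_eval x \o map_poly g.
HB.instance Definition _ := GRing.RMorphism.on ev1.

Definition ev2 : {poly {poly F}} -> R := horner_eval y \o map_poly ev1.
HB.instance Definition _ := GRing.RMorphism.on ev2.

Lemma ev1C c : ev1 c%:P = g c.
Proof. by rewrite /ev1 /= map_polyC /horner_eval hornerC. Qed.
Lemma ev1X : ev1 'X = x.
Proof. by rewrite /ev1 /= map_polyX /horner_eval hornerX. Qed.
Lemma ev2C q : ev2 q%:P = ev1 q.
Proof. by rewrite /ev2 /= map_polyC /horner_eval hornerC. Qed.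
Lemma ev2X : ev2 'X = y.
Proof. by rewrite /ev2 /= map_polyX /horner_eval hornerX. Qed.

End Evaluation.

Lemma ev2_bipoly (F : finFieldType) (R : comNzRingType) (g : {rmorphism F -> R})
    (x y : R) N (q : {ffun 'I_N.+1 * 'I_N.+1 -> F}) :
  ev2 g x y (bipoly q) =
    \sum_(ij : 'I_N.+1 * 'I_N.+1) g (q ij) * (y ^+ ij.1 * x ^+ ij.2).
Proof.
transitivity (\sum_(i < N.+1) \sum_(j < N.+1) g (q (i, j)) * (y ^+ i * x ^+ j)).
  rewrite /bipoly poly_def rmorph_sum /=.
  apply: eq_bigr => i _; rewrite -mul_polyC rmorphM rmorphXn /= ev2X ev2C.
  rewrite poly_def rmorph_sum mulr_suml; apply: eq_bigr => j _ /=.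
  by rewrite -mul_polyC rmorphM rmorphXn /= ev1C ev1X !inord_val; ring.
by rewrite pair_bigA; apply: eq_bigr => -[i j].
Qed.

Section CurveDependence.
Variable p : nat.
Hypotheses (p_pr : prime p) (p_neq2 : p != 2%N) (p_neq3 : p != 3%N).
Local Notation S := {mpoly 'F_p[3]}.
Local Notation A := (OT p).
Local Notation n := p./2.
Local Notation W := {poly {poly 'F_p}}.
Local Notation Delta := (Delta p).

Definition OT_const : 'F_p -> A := @OT_of_poly p \o @mpolyC 3 'F_p.
HB.instance Definition _ := GRing.RMorphism.on OT_const.

(** The (t2, t3)-plane as the spectrum of F_p[t2][t3], and the graph t1 = - B
    over it. *)
Definition to_plane : S -> W :=
  ev_at (@polyC {poly 'F_p} \o @polyC 'F_p) (- cohasse n 'X%:P 'X) 'X%:P 'X.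
HB.instance Definition _ := GRing.RMorphism.copy to_plane
  (ev_at (@polyC {poly 'F_p} \o @polyC 'F_p) (- cohasse n 'X%:P 'X) 'X%:P 'X).

Definition of_plane : W -> S := ev2 (@mpolyC 3 'F_p) (T2 p) (T3 p).
HB.instance Definition _ := GRing.RMorphism.on of_plane.

Lemma of_planeK : of_plane \o to_plane =1 @elim1 p.
Proof.
have e2 : of_plane 'X%:P = T2 p by rewrite /of_plane ev2C ev1X.
have e3 : of_plane 'X = T3 p by rewrite /of_plane ev2X.
apply: (rmorph_eq_coordinates p_pr); rewrite /= /to_plane /elim1.
- by rewrite !ev_atT1 rmorphN rmorph_cohasse /= e2 e3.
- by rewrite !ev_atT2.
by rewrite !ev_atT3.
Qed.

Lemma curve_dependence (b c : A) :
  exists2 Q : W, Q != 0 & ev2 OT_const c b Q \in @curve p.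
Proof.
have [Fb0 [kb bE0]] := OT_clear_denominator b.
have [Fc0 [kc cE0]] := OT_clear_denominator c.
pose k := (kb + kc)%N.
have [Fb bE] : exists F, b * Delta%:OT ^+ k = F%:OT.
  by exists (Fb0 * Delta ^+ kc); rewrite OT_of_polyM OT_of_polyX -bE0 -mulrA -exprD.
have [Fc cE] : exists F, c * Delta%:OT ^+ k = F%:OT.
  exists (Fc0 * Delta ^+ kb).
  by rewrite OT_of_polyM OT_of_polyX -cE0 -mulrA -exprD addnC.
have f0 : to_plane (eqnA p) != 0.
  apply: contraNneq (eqnA_neq0 p_pr p_neq2 p_neq3) => f0.
  by rewrite -(elim1_eqnA p) -of_planeK /= f0 rmorph0.
have [N [q [r [q0 qr]]]] :=
  dependence_modulo (to_plane Fb) (to_plane Fc) (to_plane Delta) k f0.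
exists (bipoly q) => //.
pose G : S := \sum_(ij : 'I_N.+1 * 'I_N.+1)
  (q ij)%:MP * (Fb ^+ ij.1 * Fc ^+ ij.2 * Delta ^+ (k * (N - ij.1 + (N - ij.2)))).
have GE : ev2 OT_const c b (bipoly q) * Delta%:OT ^+ (k * (N + N)) = G%:OT.
  rewrite ev2_bipoly mulr_suml rmorph_sum; apply: eq_bigr => -[i j] _ /=.
  rewrite !(OT_of_polyM, OT_of_polyX) -bE -cE !exprMn -!exprM -mulrA; congr (_ * _).
  have -> : (k * (N + N) = k * i + k * j + k * (N - i + (N - j)))%N.
    have := ltn_ord i; have := ltn_ord j; rewrite !ltnS -!mulnDr => jN iN.
    by congr (_ * _)%N; lia.
  by rewrite !exprD mulrA mulrACA.
apply/(mem_curveP p_pr GE); exists 0%N, (of_plane r).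
have -> : eqnA p * of_plane r = of_plane (to_plane (eqnA p) * r).
  rewrite [RHS](rmorphM of_plane); congr (_ * _).
  by rewrite -[RHS]/((of_plane \o to_plane) _) of_planeK elim1_eqnA.
rewrite expr0 mul1r -qr -of_planeK /=; congr of_plane.
rewrite rmorph_sum; apply: eq_bigr => ij _.
rewrite !rmorphM !rmorphXn /=; congr (_ * _).
by rewrite /to_plane ev_atC.
Qed.

End CurveDependence.

(** * Chains of primes and algebraic dependence *)

Section Chains.
Variables (F : fieldType) (A : comNzRingType) (g : {rmorphism F -> A}).
Implicit Types (P : {pred A}).

Lemma const_notin_ideal P c : idealr_closed P -> c != 0 -> g c \notin P.
Proof.
move=> idlP c0; apply: contraFN (ideal_closed1F idlP) => /(ideal_closedMl (g c^-1)).
by rewrite -rmorphM divff // rmorph1; apply.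
Qed.

(** After division by a power of a, which lies outside P0, the constant term of q
    would be in P1. *)
Lemma ev1_strip P0 P1 a (q : {poly F}) : prime_ideal P0 -> idealr_closed P1 ->
  {subset P0 <= P1} -> a \notin P0 -> a \in P1 -> q != 0 -> ev1 g a q \notin P0.
Proof.
move=> pr0 id1 P01 a0 a1; elim/poly_ind: q => [|q c IH]; first by rewrite eqxx.
move=> qc0; rewrite rmorphD rmorphM /= ev1X ev1C.
have [c0|c0] := eqVneq c 0.
  rewrite c0 rmorph0 addr0 prime_idealM // (negbTE a0) orbF IH //.
  by apply: contraNneq qc0 => ->; rewrite c0 mul0r add0r.
apply: contra (const_notin_ideal id1 c0) => /P01 qa.
rewrite (_ : g c = ev1 g a q * a + g c - ev1 g a q * a); last by rewrite addrC addKr.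
exact: ideal_closedB id1 qa (ideal_closedMr _ id1 a1).
Qed.

(** A relation between b in P1 - P0 and c in P2 - P1: after division by powers
    of b, then of c, its nonzero constant term would lie in P2. *)
Lemma no_prime_chain2 P0 P1 P2 b c (Q : {poly {poly F}}) :
  prime_ideal P0 -> prime_ideal P1 -> prime_ideal P2 ->
  {subset P0 <= P1} -> {subset P1 <= P2} ->
  b \notin P0 -> b \in P1 -> c \notin P1 -> c \in P2 -> Q != 0 ->
  ev2 g c b Q \notin P0.
Proof.
move=> pr0 pr1 pr2 P01 P12 b0 b1 c1 c2.
elim/poly_ind: Q => [|Q q IH]; first by rewrite eqxx.
move=> Qq0; rewrite rmorphD rmorphM /= ev2X ev2C.
have [q0|q0] := eqVneq q 0.
  rewrite q0 rmorph0 addr0 prime_idealM // (negbTE b0) orbF IH //.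
  by apply: contraNneq Qq0 => ->; rewrite q0 mul0r add0r.
apply: contra (ev1_strip pr1 pr2.1 P12 c1 c2 q0) => /P01 Qb.
rewrite (_ : ev1 g c q = ev2 g c b Q * b + ev1 g c q - ev2 g c b Q * b).
  exact: ideal_closedB pr1.1 Qb (ideal_closedMr _ pr1.1 b1).
by rewrite addrC addKr.
Qed.

End Chains.

(** * Algebraic elements are killed by derivations *)

Section AlgebraicDerivation.
Variables (p : nat) (p_pr : prime p) (A : comNzRingType).
Variables (g : {rmorphism 'F_p -> A}) (D : A -> A) (P : {pred A}).
Hypotheses (derD : derivation D) (prP : prime_ideal P) (invP : invariant_ideal D P).

Lemma der_Fp c : D (g c) = 0.
Proof. by rewrite -[c]natr_Zp rmorph_nat (der_nat derD). Qed.

Lemma der_ev1 a q : D (ev1 g a q) = ev1 g a q^`() * D a.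
Proof.
elim/poly_ind: q => [|q c IH]; first by rewrite deriv0 rmorph0 (der0 derD) mul0r.
rewrite rmorphD rmorphM /= ev1X ev1C derD.1 derD.2 der_Fp addr0 IH.
rewrite derivD derivC addr0 derivM derivX mulr1 rmorphD rmorphM /= ev1X; ring.
Qed.

Lemma poly_pth_power (q : {poly 'F_p}) : q^`() = 0 -> exists r, q = r ^+ p.
Proof.
move=> dq0; have p_gt0 := prime_gt0 p_pr.
have charP : p \in [pchar {poly 'F_p}].
  by rewrite (rmorph_pchar (@polyC _) (pchar_Fp p_pr)).
have pdiv i : q`_i != 0 -> (p %| i)%N.
  case: i => [|i] qi; first exact: dvdn0.
  have := congr1 (fun r : {poly 'F_p} => r`_i) dq0.
  rewrite coef_deriv coef0 -mulr_natr => /eqP.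
  by rewrite mulf_eq0 (negbTE qi) -(dvdn_pcharf (pchar_Fp p_pr)).
exists (\sum_(i < size q) q`_i *: 'X^(i %/ p)).
rewrite -(pFrobenius_autE charP) raddf_sum -{1}[q]coefK poly_def.
apply: eq_bigr => i _; rewrite /= pFrobenius_autE exprZn Fp_exp_pchar // -exprM.
have [->|qi] := eqVneq q`_i 0; first by rewrite !scale0r.
by rewrite divnK ?pdiv.
Qed.

(** A relation of minimal degree is separable, F_p being perfect, and
    q(a) in P implies q'(a) D(a) in P. *)
Lemma algebraic_der a (q : {poly 'F_p}) : q != 0 -> ev1 g a q \in P -> D a \in P.
Proof.
have [m] := ubnP (size q); elim: m q => // m IH q; rewrite ltnS => szq q0 qaP.
have [dq0|dq0] := eqVneq q^`() 0; last first.
  have := invP qaP; rewrite der_ev1 prime_idealM // => /orP[dqP|//].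
  apply: (IH q^`()) => //; apply: leq_trans szq; exact: lt_size_deriv.
have [r qE] := poly_pth_power dq0.
have r0 : r != 0 by apply: contraNneq q0 => r0; rewrite qE r0 expr0n; case: p p_pr.
apply: (IH r) => //; last first.
  by apply: (prime_idealX (m := p)) => //; rewrite -rmorphXn -qE.
apply: leq_trans szq.
have r1 : (1 < size r)%N.
  rewrite ltnNge; apply/negP => /size1_polyC rE.
  have : g (r`_0) \in P.
    by apply: (prime_idealX (m := p)) => //; rewrite -(ev1C g a) -rE -rmorphXn -qE.
  apply/negP; apply: const_notin_ideal; first exact: prP.1.
  by apply: contraNneq r0 => r00; rewrite rE r00.
have := size_exp r p; rewrite -qE; have := prime_gt1 p_pr; move: r1.
by move: (size r) (size q) => [|[|k]] // [|s] //=; nia.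
Qed.

End AlgebraicDerivation.

(** * Domains of transcendence degree one are not fields *)

Section LyingOver.
Variables (F : fieldType) (A : comNzRingType) (g : {rmorphism F -> A}).
Variables (P : {pred A}) (s : A).
Hypothesis prP : prime_ideal P.
Hypothesis s_trans : forall q : {poly F}, q != 0 -> ev1 g s q \notin P.
Hypothesis s_alg : forall b, exists2 Q : {poly {poly F}}, Q != 0 & ev2 g s b Q \in P.
Variable gens : seq A.
Hypothesis gensP : forall R : A -> Prop, (forall c, R (g c)) ->
  (forall a b, R a -> R b -> R (a + b)) -> (forall a b, R a -> R b -> R (a * b)) ->
  (forall a, a \in gens -> R a) -> forall a, R a.

Section Quotient.
Variables (B : comNzRingType) (h : {rmorphism A -> B}).
Hypothesis hP : forall a, (a \in P) = (h a == 0).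

Definition coef_ring : {poly F} -> B := h \o ev1 g s.
HB.instance Definition _ := GRing.RMorphism.on coef_ring.

Lemma coef_ring_eq0 q : coef_ring q = 0 -> q = 0.
Proof.
move=> q0; apply/eqP; apply: contraT => /s_trans; rewrite hP => /eqP[].
exact: q0.
Qed.

(** Multiplying by the leading coefficient makes an algebraic element
    integral. *)
Lemma integral_multiple b :
  exists2 c, c != 0 & integralOver coef_ring (coef_ring c * h b).
Proof.
have [Q Q0] := s_alg b; rewrite hP => /eqP Qb.
pose l := lead_coef Q; exists l; first by rewrite lead_coef_eq0.
have hev : h (ev2 g s b Q) = \sum_(i < size Q) coef_ring Q`_i * h b ^+ i.
  rewrite /ev2 /= /horner_eval (horner_coef_wide _ (size_poly _ _)) rmorph_sum.
  by apply: eq_bigr => i _; rewrite coef_map rmorphM rmorphXn.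
case szQ : (size Q) => [|[|m]].
- by move/eqP: szQ; rewrite size_poly_eq0 (negbTE Q0).
- have /size1_polyC Q1 : (size Q <= 1)%N by rewrite szQ.
  have q0 : Q`_0 != 0 by apply: contraNneq Q0 => q0; rewrite Q1 q0.
  have := s_trans q0; rewrite hP; move: hev; rewrite szQ big_ord1 Qb expr0 mulr1.
  by move=> /esym; rewrite /coef_ring /= => ->; rewrite eqxx.
pose r := \poly_(i < m.+1) (Q`_i * l ^+ (m - i)).
have szr : (size r < size ('X^(m.+1) : {poly {poly F}})%R)%N.
  by rewrite size_polyXn ltnS size_poly.
exists ('X^(m.+1) + r); first by rewrite monicE lead_coefDl // lead_coefXn.
rewrite /root rmorphD /= map_polyXn hornerD hornerXn.
have -> : (map_poly coef_ring r).[coef_ring l * h b] =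
    \sum_(i < m.+1) coef_ring (Q`_i * l ^+ (m - i)) * (coef_ring l * h b) ^+ i.
  rewrite /r poly_def rmorph_sum horner_sum; apply: eq_bigr => i _.
  by rewrite /= linearZ /= map_polyXn hornerZ hornerXn.
apply/eqP; transitivity (coef_ring l ^+ m * h (ev2 g s b Q)); last by rewrite Qb mulr0.
rewrite hev szQ [in RHS]big_ord_recr /= mulrDr mulr_sumr addrC; congr (_ + _).
  apply: eq_bigr => i _; rewrite rmorphM rmorphXn /= exprMn.
  have -> : coef_ring l ^+ m = coef_ring l ^+ (m - i) * coef_ring l ^+ i.
    by rewrite -exprD subnK // -ltnS.
  by ring.
by rewrite -[Q`__]/(Q`_(m.+2.-1)) -szQ -/(lead_coef Q) -/l exprMn exprSr; ring.
Qed.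

(** The denominators of finitely many generators bound those of all elements. *)
Lemma integral_multiple_uniform : exists2 c, c != 0 &
  forall a, exists m, integralOver coef_ring (coef_ring c ^+ m * h a).
Proof.
have [c c0 cP] : exists2 c, c != 0 & forall a, a \in gens ->
    integralOver coef_ring (coef_ring c * h a).
  elim: gens => [|a l [c c0 IH]]; first by exists 1; rewrite ?oner_eq0.
  have [d d0 dP] := integral_multiple a.
  exists (c * d); first by rewrite mulf_neq0.
  move=> b; rewrite inE => /predU1P[->|/IH bP].
    by rewrite rmorphM -mulrA; apply: integral_mul => //; exact: integral_id.
  by rewrite rmorphM mulrAC; apply: integral_mul => //; exact: integral_id.
exists c => //.
have cX m : integralOver coef_ring (coef_ring c ^+ m).
  by rewrite -rmorphXn; exact: integral_id.
apply: gensP => [x|a b [m aP] [k bP]|a b [m aP] [k bP]|a /cP ca].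
- exists 0%N; rewrite expr0 mul1r -(ev1C g s).
  exact: (integral_id coef_ring).
- exists (m + k)%N; rewrite rmorphD mulrDr exprD; apply: integral_add.
    by rewrite mulrAC; apply: integral_mul.
  by rewrite -mulrA; apply: integral_mul.
- by exists (m + k)%N; rewrite rmorphM exprD mulrACA; apply: integral_mul.
by exists 1%N; rewrite expr1.
Qed.

(** If f = c s + 1, prime to c, had an inverse modulo P, this inverse would be
    integral over F[s] up to a power of c; clearing denominators in its equation
    would make f divide a power of c. *)
Lemma not_unit_mod :
  exists2 q : {poly F}, q != 0 & 1 \notin add_principal P (ev1 g s q).
Proof.
have [c c0 cP] := integral_multiple_uniform.
pose f := c * 'X + 1.
have szf : (1 < size f)%N.
  by rewrite size_polyDl size_mulX ?size_poly1 ?ltnS ?size_poly_gt0.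
exists f; first by rewrite -size_poly_gt0 ltnW.
apply/add_principalP => -[q Pq [r e]].
have hr : h r * coef_ring f = 1.
  have hq : h q = 0 by apply/eqP; rewrite -hP.
  by have := congr1 h e; rewrite rmorph1 rmorphD rmorphM hq add0r => <-.
have [m [R monR]] := cP r; rewrite /root => /eqP Rr.
have size_R : size R = (size R).-1.+1 by rewrite prednK // size_poly_gt0 monic_neq0.
pose d := (size R).-1; pose y := coef_ring c ^+ m * h r.
have yf i : (i <= d)%N ->
    y ^+ i * coef_ring f ^+ d = coef_ring (c ^+ (m * i) * f ^+ (d - i)).
  move=> id; rewrite -{1}(subnKC id) exprD mulrA -exprMn /y -mulrA hr mulr1.
  by rewrite rmorphM !rmorphXn /= exprM.
have fdvd : f %| c ^+ (m * d).
  have : \sum_(i < d.+1) R`_i * (c ^+ (m * i) * f ^+ (d - i)) = 0.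
    apply: coef_ring_eq0; rewrite rmorph_sum /=.
    transitivity ((map_poly coef_ring R).[y] * coef_ring f ^+ d).
      rewrite (@horner_coef_wide _ (size R) (map_poly coef_ring R) y (size_poly _ _)).
      rewrite size_R mulr_suml -/d.
      apply: eq_bigr => i _; rewrite coef_map -mulrA yf; last by rewrite -ltnS ltn_ord.
      exact: (rmorphM coef_ring R`_i).
    by rewrite Rr mul0r.
  rewrite big_ord_recr /= subnn expr0 mulr1 -/(lead_coef R) (monicP monR) mul1r addrC.
  move/eqP; rewrite addr_eq0 => /eqP ->; rewrite dvdpNr.
  apply: (big_ind (fun u => f %| u)) => [|u v|i _].
  - exact: dvdp0.
  - exact: dvdp_add.
  by rewrite !dvdp_mull // dvdp_exp // subn_gt0.
have /coprimepP/(_ f (dvdpp f) fdvd)/eqp_size : coprimep f (c ^+ (m * d)).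
  by rewrite coprimep_expr // coprimep_sym /f mulrC coprimep_addl_mul coprimep1.
by move=> szf1; move: szf; rewrite szf1 size_poly1.
Qed.

End Quotient.

Lemma exists_larger_prime : exists2 P1, prime_ideal P1 & strict_subset P P1.
Proof.
have [B [h hP]] := prime_ideal_quotient prP.
have [q q0 q1] := not_unit_mod hP.
have idq := add_principal_ideal prP.1 q1.
have [|a|P1 [prP1 subP1 _]] := prime_avoiding idq (M := pred1 1).
- by split=> [|x y]; rewrite !inE // => /eqP -> /eqP ->; rewrite mulr1.
- by rewrite inE => /eqP ->.
exists P1 => //; split; first by move=> x /(add_principal_sub (ev1 g s q))/subP1.
move=> /(_ (ev1 g s q)); rewrite subP1 ?add_principal_mem //; last exact: prP.1.
by move=> /(_ isT); apply/negP/s_trans.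
Qed.

End LyingOver.

(** * The curve has pure dimension one *)

Section CurveIdeal.
Variable p : nat.
Hypotheses (p_pr : prime p) (p_neq2 : p != 2%N) (p_neq3 : p != 3%N).
Local Notation S := {mpoly 'F_p[3]}.
Local Notation A := (OT p).
Local Notation const := (@OT_const p).

Lemma singular_point_Delta (R : comNzRingType) (t1 t2 t3 : R) :
  36%:R * (27%:R * t3 ^+ 2 - t2 ^+ 3) =
    36%:R * t2 ^+ 2 * (12%:R * t1 ^+ 2 - t2)
    + 27%:R * ((4%:R * t1 * t2 - 6%:R * t3) - 8%:R * t1 * t2)
      * (4%:R * t1 * t2 - 6%:R * t3).
Proof. by ring. Qed.

(** Where v(t1) = v(t2) = 0 one has t2 = 12 t1^2 and t3 = 8 t1^3, hence
    Delta = 0. *)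
Lemma ramanujan_no_zero (P : {pred A}) : prime_ideal P ->
  ramanujan (T1 p)%:OT \in P -> ramanujan (T2 p)%:OT \in P -> False.
Proof.
move=> prP; rewrite !ramanujan_OT_of_poly ramanujan_polyT1 ramanujan_polyT2 => v1 v2.
have idP := prP.1.
have {}v1 : (12%:R * T1 p ^+ 2 - T2 p)%:OT \in P.
  have -> : 12%:R * T1 p ^+ 2 - T2 p = 12%:R * (T1 p ^+ 2 - 12%:R^-1 *: T2 p).
    by rewrite mulrBr natr_mul_scale divff ?scale1r ?Fp_12.
  by rewrite OT_of_polyM ideal_closedMr.
have : (36%:R * Delta p)%:OT \in P.
  rewrite [36%:R * _](singular_point_Delta (T1 p)) (OT_of_polyD (_ * _)).
  rewrite !(OT_of_polyM _ (_ - T2 p)).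
  rewrite (OT_of_polyM _ (_ - 6%:R * _)).
  exact: ideal_closedD idP (ideal_closedMr _ idP v1) (ideal_closedMr _ idP v2).
rewrite OT_of_polyM prime_idealM // => /orP[].
  apply/negP; rewrite -(rmorph_nat (@mpolyC 3 'F_p)).
  apply: (const_notin_ideal const idP).
  by rewrite (natrM _ 3 12) mulf_neq0 ?Fp_12 ?Fp_natr_neq0.
move/(ideal_closedMr (@Delta_inv p) idP); rewrite Delta_invK.
by rewrite (ideal_closed1F idP).
Qed.

Definition OT_gens : seq A := [:: (T1 p)%:OT; (T2 p)%:OT; (T3 p)%:OT; @Delta_inv p].

Lemma OT_generators (R : A -> Prop) : (forall c, R (const c)) ->
  (forall a b, R a -> R b -> R (a + b)) -> (forall a b, R a -> R b -> R (a * b)) ->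
  (forall a, a \in OT_gens -> R a) -> forall a, R a.
Proof.
move=> RC RD RM Rgen; have mem i (i4 : (i < 4)%N) := Rgen _ (@mem_nth _ 0 OT_gens i i4).
apply: (OT_ind p_pr); [|exact: RD|exact: RM|exact: (mem 0%N isT)|exact: (mem 1%N isT)
  |exact: (mem 2%N isT)|exact: (mem 3%N isT)].
by have := RC 1; rewrite rmorph1.
Qed.

(** A minimal prime of the curve is stable under the vector field, which has no
    zero, so not all functions can be algebraic modulo this prime. *)
Lemma minimal_prime_transcendental (P : {pred A}) : minimal_prime (@curve p) P ->
  exists s, forall q : {poly 'F_p}, q != 0 -> ev1 const s q \notin P.
Proof.
move=> minP; have [prP _ _] := minP; apply: contrapT => no_s.
have alg s : exists2 q : {poly 'F_p}, q != 0 & ev1 const s q \in P.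
  apply: contrapT => noq; apply: no_s; exists s => q q0; apply/negP => qP.
  by apply: noq; exists q.
have invP : invariant_ideal (@ramanujan p) P.
  apply: (minimal_prime_invariant (@ramanujan_derivation p) _ _ _ minP).
  - exact: curve_idealr_closed.
  - exact: curve_radical.
  exact: curve_invariant.
have vP s : ramanujan s \in P.
  have [q q0 qP] := alg s.
  exact: (algebraic_der p_pr (@ramanujan_derivation p) prP invP q0 qP).
exact: ramanujan_no_zero prP (vP _) (vP _).
Qed.

Lemma curve_is_curve : curve_ideal (@curve p).
Proof.
split; [exact: curve_idealr_closed | exact: curve_radical |].
move=> P minP; have [prP sIP _] := minP; split.
  have [s s_trans] := minimal_prime_transcendental minP.
  have [b|P1 prP1 [sP sP1]] := exists_larger_prime prP s_trans _ OT_generators.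
    have [Q Q0 QI] := curve_dependence p_pr p_neq2 p_neq3 b s.
    by exists Q => //; apply: sIP.
  exists (fun i => if i == 0%N then P else P1); split; last by case.
  by move=> [|[|i]] // _; split.
move=> [Ps [prPs strPs]].
have [pr0 s0] := prPs 0%N isT; have [pr1 _] := prPs 1%N isT; have [pr2 _] := prPs 2 isT.
have [s01 /existsNP[b /not_implyP[b1 /negP b0]]] := strPs 0%N isT.
have [s12 /existsNP[c /not_implyP[c2 /negP c1]]] := strPs 1%N isT.
have [Q Q0 QI] := curve_dependence p_pr p_neq2 p_neq3 b c.
have /negP[] := no_prime_chain2 const pr0 pr1 pr2 s01 s12 b0 b1 c1 c2 Q0.
by apply/s0/sIP.
Qed.

End CurveIdeal.

(** * The Cartier operator on dx / y and x dx / y *)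

Section Cartier.
Variables (k : fieldType) (n : nat).
Hypotheses (charK : n.*2.+1 \in [pchar k]) (n_gt1 : (1 < n)%N).
Hypothesis perfect : forall a : k, exists b : k, b ^+ n.*2.+1 = a.
Variables (K : comUnitRingType) (c : {rmorphism k -> K}) (d C : K -> K).
Variables (X y : K) (a b : k).
Hypothesis derd : derivation d.
Hypotheses (dc : forall r, d (c r) = 0) (dX : d X = 1).
Hypotheses (y_unit : y \is a GRing.unit) (y2 : y ^+ 2 = (map_poly c (cubic a b)).[X]).
Hypotheses (CD : forall u v, C (u + v) = C u + C v).
Hypotheses (CM : forall u v, C (u ^+ n.*2.+1 * v) = u * C v).
Hypotheses (Cd : forall u, C (d u) = 0).
Hypotheses (Cdlog : forall u, C (u ^+ n.*2 * d u) = d u).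
Local Notation p := n.*2.+1.

Lemma cartier_sum (I : Type) (r : seq I) (F : I -> K) :
  C (\sum_(i <- r) F i) = \sum_(i <- r) C (F i).
Proof.
have C0 : C 0 = 0 by apply: (addrI (C 0)); rewrite -CD !addr0.
exact: (big_morph C CD C0).
Qed.

(** X^i dX is exact unless i + 1 is a multiple of p, and i = p - 1 is the only
    such exponent below 2 p - 1. *)
Lemma cartier_Xn i : (i < p + n.*2)%N -> C (X ^+ i) = (i == n.*2)%:R.
Proof.
move=> ip; have [->|i_neq] := eqVneq i n.*2.
  by have := Cdlog X; rewrite dX mulr1.
have i1 : i.+1%:R != 0 :> k.
  rewrite -(dvdn_pcharf charK); apply/negP => /dvdnP[[|[|m]]] //; rewrite ?mul1n.
    by case=> /eqP; rewrite (negbTE i_neq).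
  move=> e; have : (2 * p <= m.+2 * p)%N by rewrite leq_mul2r orbT.
  by rewrite -e; lia.
have -> : X ^+ i = d (c i.+1%:R^-1 * X ^+ i.+1); last exact: Cd.
rewrite derd.2 dc mul0r add0r (derX derd) dX mulr1 /= mulrA -(rmorph_nat c) -rmorphM.
by rewrite mulVf // rmorph1 mul1r.
Qed.

Lemma pth_power_inj (r s : k) : r ^+ p = s ^+ p -> r = s.
Proof.
rewrite -!(pFrobenius_autE charK) => /eqP; rewrite -subr_eq0 -pFrobenius_autB_comm.
  by rewrite pFrobenius_autE expf_eq0 subr_eq0 => /andP[_ /eqP].
exact: mulrC.
Qed.

Lemma cartier_poly (q : {poly k}) : (size q <= p + n.*2)%N ->
  exists2 r, r ^+ p = q`_n.*2 & C (map_poly c q).[X] = c r.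
Proof.
move=> szq; have [r rE] := perfect q`_n.*2; exists r => //.
have term i : (i < p + n.*2)%N ->
    C ((map_poly c q)`_i * X ^+ i) = c (if i == n.*2 then r else 0).
  move=> ip; rewrite coef_map /=; have [s sE] := perfect q`_i.
  rewrite -sE rmorphXn CM cartier_Xn //.
  case: eqP => [i_n|_]; last by rewrite mulr0 rmorph0.
  by rewrite mulr1; congr (c _); apply: pth_power_inj; rewrite sE rE i_n.
rewrite (@horner_coef_wide _ (p + n.*2) (map_poly c q)); last first.
  by rewrite (leq_trans (size_poly _ _)).
rewrite cartier_sum; under eq_bigr => i _ do rewrite term ?ltn_ord //.
have lt : (n.*2 < p + n.*2)%N by rewrite addSn ltnS leq_addl.
rewrite (bigD1 (Ordinal lt)) //= eqxx big1 ?addr0 // => i i_neq.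
by rewrite ifN ?rmorph0.
Qed.

Lemma cubic_size : (size (cubic a b) <= 4)%N.
Proof.
apply/leq_sizeP => j j4; rewrite /cubic !coefB !coefZ coefXn coefX coefC.
by case: j j4 => [|[|[|[|j]]]] // _; rewrite !mulr0 !subr0.
Qed.

Lemma cubic_pow_size : (size (cubic a b ^+ n) <= (3 * n).+1)%N.
Proof.
apply: leq_trans (size_poly_exp_leq _ _) _; rewrite ltnS leq_mul2r.
by rewrite -subn1 leq_subLR cubic_size orbT.
Qed.

(** Since 1 / y = y^(-p) (y^2)^n, a form q(X) dX / y reduces to the
    polynomial form q (y^2)^n dX. *)
Lemma cartier_over_y (q : {poly k}) : (size q <= 2)%N ->
  exists2 r, r ^+ p = (q * cubic a b ^+ n)`_n.*2
           & C ((map_poly c q).[X] * y^-1) = c r * y^-1.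
Proof.
move=> szq; have [|r rE Cr] := @cartier_poly (q * cubic a b ^+ n).
  apply: leq_trans (size_polyMleq _ _) _; have := cubic_pow_size; move: szq.
  by move: (size q) (size (cubic a b ^+ n)%R) => s t; lia.
exists r => //; rewrite [RHS]mulrC -Cr -CM; congr (C _).
rewrite rmorphM rmorphXn /= hornerM horner_exp -y2 -exprM mul2n [RHS]mulrCA.
by rewrite exprS -mulrA exprVn mulVr ?unitrX // mulr1.
Qed.

Lemma cartier_dx : C y^-1 = y^-1 <-> hasse n a b = 1.
Proof.
have [|r rE Cr] := @cartier_over_y 1; first by rewrite size_poly1.
move: Cr rE; rewrite rmorph1 hornerC !mul1r -/(hasse n a b) => -> rE.
split=> [|h1].
  move/(congr1 (fun v => v * y)); rewrite mulVr // mulrVK // => c1.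
  by rewrite -rE (fmorph_inj c (_ : c r = c 1)) ?expr1n // rmorph1.
by rewrite (pth_power_inj (_ : r ^+ p = 1 ^+ p)) ?rmorph1 ?mul1r // expr1n rE.
Qed.

Lemma cartier_xdx t : C ((X + c t) * y^-1) = 0 <-> cohasse n a b + t * hasse n a b = 0.
Proof.
have [|r rE Cr] := @cartier_over_y ('X + t%:P).
  by rewrite size_XaddC.
move: Cr rE; rewrite rmorphD /= map_polyX map_polyC hornerD hornerX hornerC => -> rE.
have {}rE : r ^+ p = cohasse n a b + t * hasse n a b.
  rewrite rE mulrDl coefD coefXM coefCM double_eq0 ifN //.
  by case: n n_gt1.
rewrite -rE; split=> [|r0].
  move/(congr1 (fun v => v * y)); rewrite mul0r mulrVK // => c0.
  by rewrite (fmorph_inj c (_ : c r = c 0)) ?expr0n // rmorph0.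
by rewrite (pth_power_inj (_ : r ^+ p = 0 ^+ p)) ?rmorph0 ?mul0r // expr0n.
Qed.

End Cartier.

(** * Regularity of dx / y and x dx / y *)

Section RegularForms.
Variables (K : comUnitRingType) (d : K -> K).
Hypothesis derd : derivation d.

Definition subring_pred (A : K -> Prop) :=
  [/\ A 1, forall u v, A u -> A v -> A (u - v) & forall u v, A u -> A v -> A (u * v)].

(** The regular forms on the affine chart with coordinate ring A, the form w dx
    being represented by w. *)
Definition forms (A : K -> Prop) (w : K) :=
  exists s : seq (K * K), (forall ab, ab \in s -> A ab.1 /\ A ab.2) /\
    w = \sum_(ab <- s) ab.1 * d ab.2.

Section Forms.
Variable A : K -> Prop.
Hypothesis ringA : subring_pred A.

Lemma subring0 : A 0.
Proof. by case: ringA => A1 AB _; rewrite -(subrr 1); apply: AB. Qed.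
Lemma subringN u : A u -> A (- u).
Proof.
by case: ringA => _ AB _ Au; rewrite -sub0r; apply: AB => //; apply: subring0.
Qed.
Lemma subringB u v : A u -> A v -> A (u - v).
Proof. by case: ringA => _ AB _; apply: AB. Qed.
Lemma subringD u v : A u -> A v -> A (u + v).
Proof. by move=> Au Av; rewrite -[v]opprK; apply/subringB/subringN. Qed.
Lemma subringM u v : A u -> A v -> A (u * v).
Proof. by case: ringA => _ _; apply. Qed.
Lemma subring_nat m : A m%:R.
Proof.
elim: m => [|m IH]; first exact: subring0.
by rewrite -natr1; apply: subringD => //; case: ringA.
Qed.
Lemma subringX u m : A u -> A (u ^+ m).
Proof.
by move=> Au; elim: m => [|m IH]; [case: ringA | rewrite exprS; apply: subringM].
Qed.

Lemma forms0 : forms A 0.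
Proof. by exists [::]; rewrite big_nil. Qed.

Lemma formsD w w' : forms A w -> forms A w' -> forms A (w + w').
Proof.
move=> [s [As ->]] [s' [As' ->]]; exists (s ++ s'); rewrite big_cat; split=> // ab.
by rewrite mem_cat => /orP[/As|/As'].
Qed.

Lemma formsM u w : A u -> forms A w -> forms A (u * w).
Proof.
move=> Au [s [As ->]]; exists [seq (u * ab.1, ab.2) | ab <- s]; split.
  by move=> _ /mapP[ab /As[A1 A2] ->]; split=> //; apply: subringM.
by rewrite big_map mulr_sumr; apply: eq_bigr => ab _; rewrite mulrA.
Qed.

Lemma forms_d u : A u -> forms A (d u).
Proof.
move=> Au; exists [:: (1, u)]; rewrite big_seq1 mul1r; split=> // ab.
by rewrite inE => /eqP ->; split=> //; case: ringA.
Qed.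

End Forms.

Ltac in_subring rA := repeat first [assumption | exact: (subring_nat rA)
  | apply: (subringX rA) | apply: (subringN rA) | apply: (subringB rA)
  | apply: (subringD rA) | apply: (subringM rA)].

Variables (a b h D' X y : K).
Hypotheses (X_unit : X \is a GRing.unit) (y_unit : y \is a GRing.unit).
Hypotheses (h2 : 2%:R * h = 1) (DD : D' * (27%:R * b ^+ 2 - a ^+ 3) = 1).
Hypothesis dX : d X = 1.
Hypotheses (da : d a = 0) (db : d b = 0) (dh : d h = 0).
Hypothesis y2 : y ^+ 2 = 4%:R * X ^+ 3 - a * X - b.

Lemma dy : y * d y = h * (12%:R * X ^+ 2 - a).
Proof.
have := congr1 d y2; rewrite (derX derd y) !(derB derd).
rewrite (der_natM derd) (derX derd X) derd.2 da db dX /= expr1 => e2.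
have -> : y * d y = h * (2%:R * y * d y) by rewrite !mulrA [h * 2%:R]mulrC h2 mul1r.
by rewrite e2; ring.
Qed.

(** A combination of y^2 and of y dy, half the derivative of the cubic, equals
    the discriminant, a unit: divided by y it expresses dX / y by dX and dy. *)
Lemma dx_regular0 (A : K -> Prop) : subring_pred A ->
  A a -> A b -> A D' -> A X -> A y -> forms A y^-1.
Proof.
move=> rA Aa Ab AD AX Ay.
have -> : y^-1 = D' * (2%:R * (a ^+ 2 - 3%:R * X * (2%:R * a * X - 3%:R * b))) * d y
   + D' * (9%:R * (2%:R * a * X - 3%:R * b) * y) * d X.
  apply: (mulIr y_unit); rewrite mulVr // dX.
  transitivity (D' * (2%:R * (a ^+ 2 - 3%:R * X * (2%:R * a * X - 3%:R * b)))
       * (y * d y)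
     + D' * (9%:R * (2%:R * a * X - 3%:R * b)) * y ^+ 2); last by ring.
  rewrite dy y2; transitivity (D' * (27%:R * b ^+ 2 - a ^+ 3)); first by rewrite DD.
  transitivity (D' * ((2%:R * h)
      * (a ^+ 2 - 3%:R * X * (2%:R * a * X - 3%:R * b)) * (12%:R * X ^+ 2 - a)
    + 9%:R * (2%:R * a * X - 3%:R * b) * (4%:R * X ^+ 3 - a * X - b))); last by ring.
  by rewrite h2; ring.
apply: formsD; apply: (formsM rA); try exact: forms_d; in_subring rA.
Qed.

(** The coordinates u = 1 / X, w = y / X^2 at infinity. *)
Local Notation u := X^-1.
Local Notation w := (y / X ^+ 2).

Lemma Xu : X * u = 1. Proof. exact: mulrV. Qed.

Lemma wE : w = y * u ^+ 2. Proof. by rewrite exprVn. Qed.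

Lemma w2 : w ^+ 2 = u * (4%:R - a * u ^+ 2 - b * u ^+ 3).
Proof.
rewrite wE exprMn y2.
transitivity (u * (4%:R * (X * u) ^+ 3 - a * (X * u) * u ^+ 2 - b * u ^+ 3)).
  by ring.
by rewrite Xu; ring.
Qed.

Lemma du : d u = - u ^+ 2.
Proof.
have := congr1 d Xu; rewrite derd.2 dX (der1 derd) mul1r => /eqP.
rewrite addrC addr_eq0 => /eqP e.
by apply: (mulrI X_unit); rewrite e mulrN expr2 mulrA Xu mul1r.
Qed.

Lemma w2_over_y : w ^+ 2 * y^-1 = - w * d u.
Proof.
by rewrite du mulrNN expr2 -(mulrA w); congr (w * _); rewrite wE mulrAC divrr ?mul1r.
Qed.

Lemma dw_over_y : (4%:R - 3%:R * a * u ^+ 2 - 4%:R * b * u ^+ 3) * y^-1 = - 2%:R * d w.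
Proof.
move: w w2 wE => W W2 WE.
have := congr1 d W2; rewrite (derX derd W) derd.2 !(derB derd) (der_nat derd).
rewrite (derd.2 a) (derd.2 b) !(derX derd u) da db du /= => e.
have uX0 : u ^+ 2 \is a GRing.unit by rewrite unitrX ?unitrV.
apply: (mulrI uX0); apply: (mulIr y_unit); rewrite mulrA mulrVK //.
have -> : u ^+ 2 * (- 2%:R * d W) * y = - (2%:R * W ^+ 1 * d W) by rewrite WE; ring.
by rewrite e; ring.
Qed.

(** The functions r with r dx / y regular at infinity form an ideal; dividing
    by powers of u it is seen to contain the discriminant. *)
Lemma dx_regular1 (A : K -> Prop) : subring_pred A ->
  A a -> A b -> A h -> A D' -> A u -> A w -> forms A y^-1.
Proof.
move=> rA Aa Ab Ah AD Au Aw; pose J r := forms A (r * y^-1).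
have JM r s : A r -> J s -> J (r * s) by move=> Ar Js; rewrite /J -mulrA; apply: formsM.
have JD r s : J r -> J s -> J (r + s) by move=> Jr Js; rewrite /J mulrDl; apply: formsD.
have quarter r : h ^+ 2 * (4%:R * r) = r.
  by transitivity ((2%:R * h) ^+ 2 * r); [ring | rewrite h2 expr1n mul1r].
pose hp := 4%:R - 3%:R * a * u ^+ 2 - 4%:R * b * u ^+ 3.
have Jh : J (w ^+ 2).
  rewrite /J w2_over_y; apply: formsM => //; first exact: subringN.
  exact: forms_d.
have Jhp : J hp.
  rewrite /J dw_over_y; apply: formsM => //; first by in_subring rA.
  exact: forms_d.
have Ahp : A hp by rewrite /hp; in_subring rA.
pose m0 := 12%:R - a * u ^+ 2; pose q0 := 8%:R + b * u ^+ 3.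
have Am0 : A m0 by rewrite /m0; in_subring rA.
have Aq0 : A q0 by rewrite /q0; in_subring rA.
(* As hp is 4 at u = 0, it is a unit modulo u^2. *)
have divu r : A r -> J (r * u ^+ 2) -> J r.
  move=> Ar Jr; rewrite -[r]quarter.
  have -> : h ^+ 2 * (4%:R * r) =
      (h ^+ 2 * r) * hp + (h ^+ 2 * (3%:R * a + 4%:R * b * u)) * (r * u ^+ 2).
    by rewrite /hp; ring.
  by apply: JD; apply: JM => //; in_subring rA.
have Jum : J (u * m0).
  have -> : u * m0 = 4%:R * w ^+ 2 + (- u) * hp by rewrite w2 /m0 /hp; ring.
  by apply: JD; apply: JM => //; in_subring rA.
have Juq : J (u * q0).
  have -> : u * q0 = h ^+ 2 * (4%:R * (u * q0)) by rewrite quarter.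
  have -> : h ^+ 2 * (4%:R * (u * q0)) =
      h ^+ 2 * 3%:R * (u * m0) + (- (h ^+ 2 * u)) * hp.
    by rewrite /m0 /q0 /hp; ring.
  by apply: JD; apply: JM => //; in_subring rA.
have Jm : J m0.
  by apply: divu => //; rewrite expr2 mulrCA mulrC [m0 * u]mulrC mulrC; apply: JM.
have Jq : J q0.
  by apply: divu => //; rewrite expr2 mulrCA mulrC [q0 * u]mulrC mulrC; apply: JM.
have JDu : J ((27%:R * b ^+ 2 - a ^+ 3) * u ^+ 6).
  have -> : (27%:R * b ^+ 2 - a ^+ 3) * u ^+ 6 =
     (27%:R * b * u ^+ 3 - 216%:R) * q0
     + (a ^+ 2 * u ^+ 4 + 12%:R * a * u ^+ 2 + 144%:R) * m0.
    by rewrite /q0 /m0; ring.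
  by apply: JD; apply: JM => //; in_subring rA.
have AD2 : A (27%:R * b ^+ 2 - a ^+ 3) by in_subring rA.
have JDe : J (27%:R * b ^+ 2 - a ^+ 3).
  apply: (divu) => //; apply: (divu); first by in_subring rA.
  apply: (divu); first by in_subring rA.
  have -> : (27%:R * b ^+ 2 - a ^+ 3) * u ^+ 2 * u ^+ 2 * u ^+ 2 =
    (27%:R * b ^+ 2 - a ^+ 3) * u ^+ 6 by ring.
  exact: JDu.
by have := JM _ _ AD JDe; rewrite /J DD mul1r.
Qed.

(** The double pole of x dx / y at infinity is that of d (y / 2 X): the
    difference is a multiple of dx / y by a polynomial in u. *)
Lemma xdx_at_infinity :
  X * y^-1 + d (- (y / (2%:R * X))) = - (h ^+ 2 * a * u + h * b * u ^+ 2) * y^-1.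
Proof.
have half : (2%:R : K) \is a GRing.unit by apply/unitrP; exists h; rewrite mulrC h2.
have -> : y / (2%:R * X) = h * y * u.
  have -> : (2%:R * X)^-1 = h * u; last by ring.
  have X2 : 2%:R * X \is a GRing.unit by rewrite unitrM half.
  by apply: (mulrI X2); rewrite divrr // mulrACA h2 Xu mulr1.
apply: (mulIr y_unit); rewrite mulrVK // mulrDl mulrVK //.
rewrite (derN derd) !derd.2 dh mul0r add0r du.
transitivity (X - h * (y * d y) * u + h * y ^+ 2 * u ^+ 2); first by ring.
rewrite dy y2.
transitivity (X - h ^+ 2 * (12%:R * X * (X * u) - a * u)
  + h * (4%:R * X * (X * u) ^+ 2 - a * u * (X * u) - b * u ^+ 2)); first by ring.
rewrite Xu.
transitivity (X - 3%:R * (2%:R * h) ^+ 2 * X + 2%:R * (2%:R * h) * X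
  + h ^+ 2 * a * u - h * a * u - h * b * u ^+ 2); first by ring.
rewrite h2.
have -> : h * a * u = 2%:R * h * h * a * u by rewrite h2 mul1r.
by ring.
Qed.

End RegularForms.

(** * The function field of the elliptic curve *)

Section FunctionField.
Import Pdiv.CommonRing Pdiv.RingMonic.
Variables (k : fieldType) (t1 t2 t3 : k).
Hypothesis two_neq0 : 2%:R != 0 :> k.
Local Notation f := (weierstrass_cubic t1 t2 t3).
Local Notation kx := {fraction {poly k}}.
Local Notation K := (function_field t1 t2 t3).
Local Notation xE := (xE t1 t2 t3).
Local Notation yE := (yE t1 t2 t3).
Local Notation XE := (XE t1 t2 t3).
Local Notation of_kx := (@of_kx k t1 t2 t3).
Local Notation of_k := (@of_k k t1 t2 t3).
Local Notation dE := (@dE k t1 t2 t3).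

Definition curve_poly : {poly kx} := 'X^2 - (f%:F)%:P.
Definition class (G : {poly kx}) : K := in_qpoly curve_poly G.

HB.instance Definition _ := GRing.RMorphism.copy of_kx (qpolyC curve_poly).
HB.instance Definition _ := GRing.RMorphism.copy class (in_qpoly curve_poly).
HB.instance Definition _ := GRing.RMorphism.copy of_k
  (of_kx \o (@FracField.tofrac {poly k}) \o polyC).

Lemma curve_poly_monic : curve_poly \is monic.
Proof. by rewrite /curve_poly; apply: monicXnsubC. Qed.

Lemma size_curve_poly : size curve_poly = 3.
Proof. exact: size_XnsubC. Qed.

Lemma mk_monic_curve : mk_monic curve_poly = curve_poly.
Proof. by rewrite /mk_monic size_curve_poly curve_poly_monic. Qed.

Lemma classK (G : K) : class G = G.
Proof. by apply: val_inj; rewrite /= rmodp_small // size_mk_monic. Qed.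

Lemma classC r : class r%:P = of_kx r.
Proof.
apply: val_inj; rewrite /= rmodp_small // mk_monic_curve size_curve_poly.
by apply: leq_ltn_trans (size_polyC_leq1 _) _.
Qed.

Lemma classX : class 'X = yE. Proof. by []. Qed.

Lemma class_curve : class curve_poly = 0.
Proof. by apply: val_inj; rewrite /= mk_monic_curve rmodpp ?curve_poly_monic. Qed.

Lemma yE2 : yE ^+ 2 = of_kx f%:F.
Proof.
have := class_curve; rewrite /curve_poly rmorphB rmorphXn /= classX classC.
by move/eqP; rewrite subr_eq0 => /eqP.
Qed.

Lemma class_eq (G H : {poly kx}) :
  class G = class H -> exists Q, G = H + Q * curve_poly.
Proof.
move=> /(congr1 val) /=; rewrite mk_monic_curve => e; have mon := curve_poly_monic.
exists (rdivp G curve_poly - rdivp H curve_poly).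
rewrite {1}(rdivp_eq mon G) {1}(rdivp_eq mon H) e; ring.
Qed.

Lemma of_k_natr m : of_k m%:R = m%:R. Proof. exact: rmorph_nat. Qed.

Lemma two_unit : (2%:R : K) \is a GRing.unit.
Proof. by rewrite -(of_k_natr 2) rmorph_unit // unitfE. Qed.

Lemma weierstrass_neq0 : f != 0.
Proof.
have four0 : 4%:R != 0 :> k by rewrite (natrM _ 2 2) mulf_neq0.
apply: contraNneq four0 => f0.
have := congr1 (fun q : {poly k} => (q \Po ('X + t1%:P))`_3) f0.
rewrite comp_poly0 coef0 /weierstrass_cubic !comp_polyB !comp_polyZ comp_polyB.
rewrite rmorphXn /= comp_polyB comp_polyX !comp_polyC addrK => <-.
by rewrite !coefB !coefZ coefXn coefX coefC /= mulr1 mulr0 !subr0.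
Qed.

Lemma yE_unit : yE \is a GRing.unit.
Proof.
have : yE ^+ 2 \is a GRing.unit.
  by rewrite yE2 rmorph_unit // unitfE tofrac_eq0 weierstrass_neq0.
by rewrite unitrX_pos.
Qed.

(** The derivation of k(x)[y] that extends d / dx and sends y to f' / 2 y.  It
    kills y^2 - f, hence is defined on the function field. *)
Definition pre_dE (G : {poly kx}) : K :=
  class (map_poly (frac_der (@deriv k)) G)
  + class G^`() * (of_kx (f^`())%:F / (2%:R * yE)).

Lemma deriv_derivation : derivation (@deriv k).
Proof. by split; [exact: derivD | exact: derivM]. Qed.

Lemma frac_deriv_derivation : derivation (frac_der (@deriv k)).
Proof. exact: frac_der_derivation deriv_derivation. Qed.

Lemma pre_dED G H : pre_dE (G + H) = pre_dE G + pre_dE H.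
Proof.
rewrite /pre_dE (map_poly_derivation frac_deriv_derivation).1 derivD !rmorphD /= mulrDl.
by rewrite addrACA.
Qed.

Lemma pre_dEM G H : pre_dE (G * H) = pre_dE G * class H + class G * pre_dE H.
Proof.
rewrite /pre_dE (map_poly_derivation frac_deriv_derivation).2 derivM.
rewrite !rmorphD !rmorphM /=; move: (_ / (_ * yE)) => r.
by rewrite !mulrDr !mulrDl !mulrA addrACA; congr (_ + (_ + _)); rewrite mulrAC.
Qed.

Lemma pre_dE_curve : pre_dE curve_poly = 0.
Proof.
have derF := frac_deriv_derivation; have derP := map_poly_derivation derF.
rewrite /pre_dE /curve_poly (derB derP) (derX derP) (map_derX derF) mulr0 sub0r.
rewrite (map_derC derF) (frac_der_tofrac deriv_derivation).
rewrite (derivB 'X^2) (derivC f%:F) subr0 derivXn expr1 rmorphN rmorphMn /=.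
rewrite classC classX.
by rewrite -mulr_natl mulrC divrK ?addNr // unitrM two_unit yE_unit.
Qed.

Lemma pre_dE_class G : pre_dE G = dE (class G).
Proof.
have [Q GE] := class_eq (esym (classK (class G))).
rewrite -[RHS]/(pre_dE (class G)) {1}GE pre_dED pre_dEM class_curve pre_dE_curve.
by rewrite !mulr0 !addr0.
Qed.

Lemma dE_derivation : derivation dE.
Proof.
split=> G H.
  by rewrite -[in LHS](classK G) -[in LHS](classK H) -rmorphD -pre_dE_class pre_dED.
rewrite -[in LHS](classK G) -[in LHS](classK H) -rmorphM -pre_dE_class pre_dEM.
by rewrite !classK.
Qed.

Lemma dE_of_kx r : dE (of_kx r) = of_kx (frac_der (@deriv k) r).
Proof.
rewrite -classC -pre_dE_class /pre_dE derivC rmorph0 mul0r addr0 -classC.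
by rewrite (map_derC frac_deriv_derivation).
Qed.

Lemma dE_of_k r : dE (of_k r) = 0.
Proof.
rewrite /Defs.of_k dE_of_kx (frac_der_tofrac deriv_derivation) derivC.
by rewrite tofrac0 rmorph0.
Qed.

Lemma dE_XE : dE XE = 1.
Proof.
rewrite /Defs.XE (derB dE_derivation) dE_of_k subr0 /Defs.xE dE_of_kx.
by rewrite (frac_der_tofrac deriv_derivation) derivX tofrac1 rmorph1.
Qed.

Lemma XE_unit : XE \is a GRing.unit.
Proof.
rewrite /Defs.XE /Defs.xE /Defs.of_k -rmorphB rmorph_unit // unitfE -tofracB tofrac_eq0.
by rewrite polyXsubC_eq0.
Qed.

Lemma map_of_k_XE (q : {poly k}) :
  (map_poly of_k q).[XE] = of_kx (q \Po ('X - t1%:P))%:F.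
Proof.
elim/poly_ind: q => [|q c IH].
  by rewrite rmorph0 horner0 comp_poly0 tofrac0 rmorph0.
rewrite rmorphD rmorphM /= map_polyX map_polyC !hornerE IH comp_poly_MXaddC.
by rewrite tofracD tofracM rmorphD rmorphM /= tofracB rmorphB.
Qed.

Lemma yE2_cubic : yE ^+ 2 = (map_poly of_k (cubic t2 t3)).[XE].
Proof.
rewrite map_of_k_XE yE2 /cubic /weierstrass_cubic !comp_polyB !comp_polyZ.
rewrite comp_polyX comp_polyC.
by rewrite rmorphXn /= comp_polyX.
Qed.

End FunctionField.

(** * De Rham classes and rational points *)

Section AdjoinTwo.
Variables (k : comNzRingType) (R : comUnitRingType) (g : {rmorphism k -> R}) (u v : R).

Definition adjoin_two (w : R) := exists P, w = ev2 g u v P.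

Lemma adjoin_two_subring : subring_pred adjoin_two.
Proof.
split=> [|_ _ [P ->] [Q ->]|_ _ [P ->] [Q ->]].
- by exists 1; rewrite (rmorph1 (ev2 g u v)).
- by exists (P - Q); rewrite raddfB.
by exists (P * Q); rewrite rmorphM.
Qed.

Lemma adjoin_two_const r : adjoin_two (g r).
Proof. by exists r%:P%:P; rewrite ev2C ev1C. Qed.
Lemma adjoin_two_l : adjoin_two u.
Proof. by exists 'X%:P; rewrite ev2C ev1X. Qed.
Lemma adjoin_two_r : adjoin_two v.
Proof. by exists 'X; rewrite ev2X. Qed.

End AdjoinTwo.

Section Constants.
Variables (k : fieldType) (R : comUnitRingType) (c : {rmorphism k -> R}) (X y : R).
Hypotheses (two_neq0 : 2%:R != 0 :> k) (X_unit : X \is a GRing.unit).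

Lemma half_const : 2%:R * c 2%:R^-1 = 1.
Proof. by rewrite -(rmorph_nat c) -rmorphM divff // rmorph1. Qed.

Lemma disc_inv_const a b : 27%:R * b ^+ 2 - a ^+ 3 != 0 ->
  c (27%:R * b ^+ 2 - a ^+ 3)^-1 * (27%:R * c b ^+ 2 - c a ^+ 3) = 1.
Proof.
move=> disc; rewrite -(rmorph_nat c) -!rmorphXn -rmorphM -rmorphB -rmorphM.
by rewrite mulVf // rmorph1.
Qed.

Lemma horner_map_cubic a b :
  (map_poly c (cubic a b)).[X] = 4%:R * X ^+ 3 - c a * X - c b.
Proof.
by rewrite map_cubic /cubic !hornerE.
Qed.

Lemma pole_cancel : X * - (y / (2%:R * X)) = c (- 2%:R^-1) * y.
Proof.
have X2 : 2%:R * X \is a GRing.unit.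
  rewrite unitrM X_unit andbT; apply/unitrP.
  by exists (c 2%:R^-1); rewrite mulrC half_const.
apply: (mulrI X2); rewrite mulrN mulrN rmorphN mulNr mulrN; congr (- _).
transitivity (X * y * (2%:R * X / (2%:R * X))); first by ring.
rewrite divrr // mulr1; transitivity ((2%:R * c 2%:R^-1) * (X * y)); last by ring.
by rewrite half_const mul1r.
Qed.

End Constants.

Section Points.
Variables (k : fieldType) (n : nat) (t1 t2 t3 : k).
Hypotheses (chark : n.*2.+1 \in [pchar k]) (n_gt1 : (1 < n)%N).
Hypothesis perfect : forall a : k, exists b : k, b ^+ n.*2.+1 = a.
Hypothesis disc : 27%:R * t3 ^+ 2 - t2 ^+ 3 != 0.
Local Notation p := n.*2.+1.
Local Notation K := (function_field t1 t2 t3).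
Local Notation yE := (yE t1 t2 t3).
Local Notation xE := (xE t1 t2 t3).
Local Notation XE := (XE t1 t2 t3).
Local Notation of_k := (@of_k k t1 t2 t3).
Local Notation dE := (@dE k t1 t2 t3).

Lemma pchar2 : 2%:R != 0 :> k.
Proof. by apply: (natr_small_neq0 chark n_gt1). Qed.

Lemma adjoin2E (u v : K) : @adjoin2 k t1 t2 t3 u v = adjoin_two of_k u v.
Proof. by []. Qed.

Lemma adjoin2_subring (u v : K) : subring_pred (adjoin2 u v).
Proof. rewrite adjoin2E; exact: adjoin_two_subring. Qed.

Lemma adjoin2_const (u v : K) r : adjoin2 u v (of_k r).
Proof. rewrite adjoin2E; exact: adjoin_two_const. Qed.

Lemma adjoin2_l (u v : K) : adjoin2 u v u.
Proof. rewrite adjoin2E; exact: adjoin_two_l. Qed.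

Lemma adjoin2_r (u v : K) : adjoin2 u v v.
Proof. rewrite adjoin2E; exact: adjoin_two_r. Qed.

Let a : K := of_k t2.
Let b : K := of_k t3.
Let h : K := of_k 2%:R^-1.
Let D' : K := of_k (27%:R * t3 ^+ 2 - t2 ^+ 3)^-1.
Let X_unit := XE_unit t1 t2 t3.
Let y_unit := yE_unit t1 t2 t3 pchar2.
Let derE := dE_derivation t1 t2 t3 pchar2.
Let dk := dE_of_k t1 t2 t3 pchar2.
Let dX := dE_XE t1 t2 t3 pchar2.

Lemma half_constE : 2%:R * h = 1.
Proof. exact: half_const pchar2. Qed.

Lemma disc_inv_constE : D' * (27%:R * b ^+ 2 - a ^+ 3) = 1.
Proof. exact: disc_inv_const disc. Qed.

Lemma yE2E : yE ^+ 2 = 4%:R * XE ^+ 3 - a * XE - b.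
Proof. rewrite yE2_cubic; exact: horner_map_cubic. Qed.

Lemma dx_global : global_differential (dx_over_y t1 t2 t3).
Proof.
have R0 := adjoin2_subring XE yE; have R1 := adjoin2_subring XE^-1 (yE / XE ^+ 2).
split.
  apply: (dx_regular0 derE y_unit half_constE disc_inv_constE dX (dk _) (dk _)
    yE2E R0); try exact: adjoin2_const; [exact: adjoin2_l | exact: adjoin2_r].
apply: (dx_regular1 derE X_unit y_unit half_constE disc_inv_constE dX (dk _) (dk _)
  yE2E R1); try exact: adjoin2_const; [exact: adjoin2_l | exact: adjoin2_r].
Qed.

Definition alpha_cochain : dR_cochain t1 t2 t3 :=
  DRCochain (dx_over_y t1 t2 t3) (dx_over_y t1 t2 t3) 0.

Definition omega_cochain : dR_cochain t1 t2 t3 :=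
  let f10 := - (yE / (2%:R * XE)) in
  DRCochain (xE * dx_over_y t1 t2 t3) (xE * dx_over_y t1 t2 t3 + dE f10) f10.

Lemma alpha_cocycle : dR_cocycle alpha_cochain.
Proof.
have [r0 r1] := dx_global; split=> //=.
  by exists 0%N; rewrite mulr0; apply: subring0; apply: adjoin2_subring.
by rewrite subrr (der0 derE).
Qed.

Lemma omega_cocycle : dR_cocycle omega_cochain.
Proof.
have [r0 r1] := dx_global.
have xX : xE = XE + of_k t1 by rewrite /Defs.XE subrK.
have R0 := adjoin2_subring XE yE; have R1 := adjoin2_subring XE^-1 (yE / XE ^+ 2).
have c0 := adjoin2_const XE yE; have c1 := adjoin2_const XE^-1 (yE / XE ^+ 2).
split=> /=.
- apply: (formsM R0) => //; rewrite xX; apply: (subringD R0); last exact: c0.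
  exact: adjoin2_l.
- rewrite xX mulrDl addrAC.
  rewrite (xdx_at_infinity derE X_unit y_unit half_constE dX (dk _) (dk _) (dk _) yE2E).
  rewrite -mulrDl; apply: (formsM R1) => //.
  have u1 := adjoin2_l XE^-1 (yE / XE ^+ 2).
  apply: (subringD R1); last exact: c1.
  apply: (subringN R1); apply: (subringD R1).
    apply: (subringM R1) => //; apply: (subringM R1); last exact: c1.
    by apply: (subringX R1); exact: c1.
  apply: (subringM R1); last exact: (subringX R1).
  by apply: (subringM R1); exact: c1.
- exists 1%N; rewrite expr1.
  rewrite (pole_cancel of_k _ pchar2 X_unit).
  by apply: (subringM R0); [exact: c0 | exact: adjoin2_r].
by rewrite addrC addKr.
Qed.

Lemma dR_class_self c : dR_cocycle c -> @dR_class k t1 t2 t3 c c.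
Proof.
move=> cc; split=> //; exists 0, 0; rewrite !subrr (der0 derE); split=> //.
  by apply: subring0; apply: adjoin2_subring.
by apply: subring0; apply: adjoin2_subring.
Qed.

Variable C : differential t1 t2 t3 -> differential t1 t2 t3.
Hypothesis cartC : is_cartier p C.

(** Cohomologous cocycles differ by exact forms, which C kills. *)
Lemma cartier_dR_form0 c w : cartier_dR C (dR_class c) w -> C (form0 c) = w.
Proof.
case: cartC => CD _ Cd _ [_ [c' [[_ [g0 [g1 [_ _ e0 _ _]]]] <- _]]].
by rewrite -[form0 c'](subrK (form0 c)) e0 CD Cd add0r.
Qed.

Lemma cartier_condition_forms : cartier_condition C <->
  C yE^-1 = yE^-1 /\ C ((XE + of_k t1) * yE^-1) = 0.
Proof.
have xX : xE = XE + of_k t1 by rewrite /Defs.XE subrK.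
rewrite -xX; split=> [[/cartier_dR_form0 al /cartier_dR_form0 om] //|[al om]].
have [CD _ Cd _] := cartC; split; split; try exact: dx_global.
- exists alpha_cochain; split=> //; apply: dR_class_self; exact: alpha_cocycle.
- by split; exact: forms0.
exists omega_cochain; split=> //; first by apply: dR_class_self; exact: omega_cocycle.
by rewrite /= CD Cd addr0.
Qed.

Lemma cartier_conditionE :
  cartier_condition C <-> hasse n t2 t3 = 1 /\ t1 + cohasse n t2 t3 = 0.
Proof.
have [CD CM Cd Clog] := cartC.
have dx := cartier_dx chark n_gt1 perfect derE dk dX y_unit (yE2_cubic _ _ _)
  CD CM Cd Clog.
have xdx := cartier_xdx chark n_gt1 perfect derE dk dX y_unit (yE2_cubic _ _ _)
  CD CM Cd Clog t1.
split=> [/cartier_condition_forms[/dx A1 /xdx B0]|[A1 B0]].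
  by rewrite A1 mulr1 addrC in B0.
apply/cartier_condition_forms; split; first exact/dx.
by apply/xdx; rewrite A1 mulr1 addrC.
Qed.

End Points.

Section CurvePoints.
Variables (p : nat) (R : comNzRingType) (x : {rmorphism OT p -> R}).

Lemma eqnA_at : x (eqnA p)%:OT = hasse p./2 (x (T2 p)%:OT) (x (T3 p)%:OT) - 1.
Proof.
rewrite eqnAE !rmorphB !rmorph1 /hasseT; congr (_ - 1).
by rewrite -[LHS]/((x \o @OT_of_poly p) _) rmorph_hasse.
Qed.

Lemma eqnB_at :
  x (eqnB p)%:OT = x (T1 p)%:OT + cohasse p./2 (x (T2 p)%:OT) (x (T3 p)%:OT).
Proof.
rewrite eqnBE !rmorphD /cohasseT; congr (_ + _).
by rewrite -[LHS]/((x \o @OT_of_poly p) _) rmorph_cohasse.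
Qed.

Lemma curve_points : (forall a, a \in @curve p -> x a = 0) <->
  hasse p./2 (x (T2 p)%:OT) (x (T3 p)%:OT) = 1 /\
  x (T1 p)%:OT + cohasse p./2 (x (T2 p)%:OT) (x (T3 p)%:OT) = 0.
Proof.
split=> [x0|[A1 B0] _ /curveP[b [c ->]]].
  split.
    apply/eqP; rewrite -subr_eq0 -eqnA_at; apply/eqP/x0/curveP.
    by exists 1, 0; rewrite mul1r mul0r addr0.
  rewrite -eqnB_at; apply/x0/curveP.
  by exists 0, 1; rewrite mul1r mul0r add0r.
by rewrite rmorphD !rmorphM /= eqnA_at eqnB_at A1 B0 subrr !mulr0 addr0.
Qed.

Lemma Delta_at : x (Delta p)%:OT = 27%:R * x (T3 p)%:OT ^+ 2 - x (T2 p)%:OT ^+ 3.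
Proof.
by rewrite -[LHS]/((x \o @OT_of_poly p) _) /Delta rmorphB rmorphM !rmorphXn rmorph_nat.
Qed.

End CurvePoints.

Theorem theorem4p2 (p : nat) (p_pr : prime p) (p_neq2 : p != 2%N)
    (p_neq3 : p != 3%N) :
  exists I : {pred OT p},
    [/\ curve_ideal I,
        invariant_ideal (@ramanujan p) I &
        forall (k : fieldType), p \in [pchar k] ->
          (forall a : k, exists b : k, b ^+ p = a) ->
        forall x : {rmorphism OT p -> k},
        let t1 := x (OT_of_poly (T1 p)) in
        let t2 := x (OT_of_poly (T2 p)) in
        let t3 := x (OT_of_poly (T3 p)) in
        forall C : differential t1 t2 t3 -> differential t1 t2 t3,
          is_cartier p C ->
          ((forall a : OT p, a \in I -> x a = 0) <-> cartier_condition C)].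
Proof.
exists (@curve p); split.
- exact: curve_is_curve.
- exact: curve_invariant.
move=> k chark perfect x t1 t2 t3 C cartC.
have pE := pchar_doubleS p_pr p_neq2.
have charn : p./2.*2.+1 \in [pchar k] by rewrite pE.
have perfectn (a : k) : exists b : k, b ^+ p./2.*2.+1 = a by rewrite pE.
have cartn : is_cartier p./2.*2.+1 C by rewrite pE.
have disc : 27%:R * t3 ^+ 2 - t2 ^+ 3 != 0.
  rewrite -(Delta_at x); apply: contra_neq (oner_neq0 k) => D0.
  by rewrite -(rmorph1 x) -Delta_invK rmorphM /= D0 mulr0.
have n_gt1 := half_pchar_gt1 p_pr p_neq2 p_neq3.
rewrite (cartier_conditionE charn n_gt1 perfectn disc cartn).
exact: curve_points.
Qed.
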